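(* Let $m\in\mathbb{N}$. For any $V\in H_{per}^{-m}[-1,1]$ there exist $\varepsilon>0$, $M=M(\varepsilon)\geq 1$ and $n_{0}=n_{0}(\varepsilon)\in\mathbb{N}$ such that for any $W\in H_{per}^{-m}[-1,1]$ with $\|W-V\|_{-m}\leq\varepsilon$ the spectrum of the operator $L_{m}(W)$, consisting of the eigenvalues $(\lambda_k(W))_{k\ge 0}$ (counted with algebraic multiplicity and ordered lexicographically), satisfies the following estimates: (a) There are precisely $2n_0-1$ eigenvalues (counted with algebraic multiplicity) inside the bounded cone $$T_{M,n_0}=\left\{\lambda\in\mathbb{C}\;:\;|\operatorname{Im}\lambda|-M\leq \operatorname{Re}\lambda\leq (n_{0}^{2m}-n_{0}^{m})\pi^{2m}\right\}.$$ (b) For any $n\geq n_0$ the pair of eigenvalues $\lambda_{2n-1}(W)$, $\lambda_{2n}(W)$ lies inside the disc around $n^{2m}\pi^{2m}$ of radius $n^{m}$: $$|\lambda_{2n-1}(W)-n^{2m}\pi^{2m}|<n^{m},\qquad |\lambda_{2n}(W)-n^{2m}\pi^{2m}|<n^{m}.$$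
   Context: For $s\in\mathbb{R}$, $H_{per}^{s}[-1,1]$ is the complex Sobolev space of 2-periodic functions or distributions $f=\sum_{k\in\mathbb{Z}}\hat f(k)e^{ik\pi x}$ with $\|f\|_{s}:=\left(\sum_{k\in\mathbb{Z}}\langle k\rangle^{2s}|\hat f(k)|^{2}\right)^{1/2}<\infty$, where $\langle k\rangle:=1+|k|$ and $\hat f(k):=\langle f,e^{ik\pi x}\rangle$; the brackets denote the sesquilinear pairing between $H_{per}^{s}[-1,1]$ and $H_{per}^{-s}[-1,1]$ extending the inner product $\langle f,g\rangle=\frac12\int_{-1}^{1}f(x)\overline{g(x)}\,dx$ on $L^2_{per}[-1,1]$. For $m\in\mathbb{N}$ and a (complex-valued) distribution $V\in H_{per}^{-m}[-1,1]$, $L_m(V):=(-1)^{m}\frac{d^{2m}}{dx^{2m}}+V$ is the unbounded linear operator in the Hilbert space $H_{per}^{-m}[-1,1]$ with inner product $\langle f,g\rangle_{-m}=\sum_{k}\langle k\rangle^{-2m}\hat f(k)\overline{\hat g(k)}$ and with domain $H_{per}^{m}[-1,1]$. Here $V$ acts on $f\in H_{per}^{m}[-1,1]$ by multiplication $f\mapsto V\cdot f\in H_{per}^{-m}[-1,1]$, defined through Fourier coefficients by $\widehat{V\cdot f}(k)=\sum_{j\in\mathbb{Z}}\hat V(k-j)\hat f(j)$. The spectrum of $L_m(V)$ is discrete and consists of a sequence of eigenvalues $\lambda_k=\lambda_k(m,V)$, $k\in\mathbb{Z}_+=\{0,1,2,\dots\}$, with $\operatorname{Re}\lambda_k\to+\infty$,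 enumerated with algebraic multiplicities and ordered lexicographically: for each $k$, either $\operatorname{Re}\lambda_k<\operatorname{Re}\lambda_{k+1}$, or $\operatorname{Re}\lambda_k=\operatorname{Re}\lambda_{k+1}$ and $\operatorname{Im}\lambda_k\leq\operatorname{Im}\lambda_{k+1}$. The notation $\lambda_k(W)$ abbreviates $\lambda_k(m,W)$. *)

(* Defs.v *)
From HB Require Import structures.
From mathcomp Require Import all_boot all_order all_algebra.
From mathcomp Require Export complex.
From mathcomp Require Import all_classical all_reals all_analysis.
Set Implicit Arguments.
Unset Strict Implicit.
Unset Printing Implicit Defensive.
Import Order.TTheory GRing.Theory Num.Theory.
Import numFieldNormedType.Exports.
Local Open Scope classical_set_scope.
Local Open Scope card_scope.
Local Open Scope complex_scope.
Local Open Scope ring_scope.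

(* A 2-periodic distribution is represented by its Fourier coefficients
   k |-> fhat(k), i.e. by the formal series \sum_k fhat(k) e^{i k pi x};
   [sobolev s] cuts out those that belong to H^s_per[-1,1]. *)
Definition fourier (R : realType) : Type := int -> R[i].

Definition bracket (R : realType) (k : int) : R := 1 + (absz k)%:R.

Definition sobolev_norm (R : realType) (s : R) (f : fourier R) : \bar R :=
  poweR (\esum_(k in [set: int])
    ((bracket R k `^ (2 * s)) * complex.Re `|f k| ^+ 2)%:E) 2^-1.

Definition sobolev (R : realType) (s : R) : set (fourier R) :=
  [set f | (sobolev_norm s f < +oo)%E].

(* Limit of the symmetric partial sums, taken on the real and imaginary parts.
   It is the usual sum as soon as the family is absolutely summable, which is
   the case for the coefficients of a product of an element of H^{-m} with an
   element of H^m. *)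
Definition int_sum (R : realType) (u : int -> R[i]) : R[i] :=
  let part (n : nat) : R[i] := \sum_(j < n.*2.+1) u (j%:Z - n%:Z) in
  lim ((fun n => complex.Re (part n)) @ \oo)
  +i* lim ((fun n => complex.Im (part n)) @ \oo).

Definition fourier_mul (R : realType) (V f : fourier R) : fourier R :=
  fun k => int_sum (fun j => V (k - j) * f j).

(* d/dx e^{i k pi x} = i k pi e^{i k pi x} *)
Definition fourier_deriv (R : realType) (f : fourier R) : fourier R :=
  fun k => 'i%C * k%:~R * (pi : R)%:C * f k.

(* Its domain is [sobolev m%:R], as a subspace of [sobolev (- m%:R)]. *)
Definition L (R : realType) (m : nat) (V f : fourier R) : fourier R :=
  fun k => (-1) ^+ m * iter m.*2 (@fourier_deriv R) f k + fourier_mul V f k.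

Definition L_shift (R : realType) (m : nat) (V : fourier R) (z : R[i])
    (f : fourier R) : fourier R :=
  fun k => L m V f k - z * f k.

Definition resolvent_set (R : realType) (m : nat) (V : fourier R) : set R[i] :=
  [set z |
    (forall g, sobolev (- m%:R) g ->
       exists! f, sobolev m%:R f /\ L_shift m V z f = g) /\
    (exists K : R, forall f, sobolev m%:R f ->
       (sobolev_norm (- m%:R) f <=
        K%:E * sobolev_norm (- m%:R) (L_shift m V z f))%E)].

Definition spectrum (R : realType) (m : nat) (V : fourier R) : set R[i] :=
  ~` resolvent_set m V.

Definition eigenvalue (R : realType) (m : nat) (V : fourier R) (z : R[i]) :
    Prop :=
  exists f, [/\ sobolev m%:R f, f <> (fun=> 0) & L_shift m V z f = (fun=> 0)].

(* The kernel of the j-th power of the unbounded operator L - z: the domain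
   condition is imposed on f, (L - z) f, ..., (L - z)^(j-1) f. *)
Fixpoint ker_pow (R : realType) (m : nat) (V : fourier R) (z : R[i])
    (j : nat) : set (fourier R) :=
  match j with
  | 0%N => [set (fun=> 0)]
  | j'.+1 => [set f | sobolev m%:R f /\ ker_pow m V z j' (L_shift m V z f)]
  end.

Definition root_space (R : realType) (m : nat) (V : fourier R) (z : R[i]) :
    set (fourier R) :=
  \bigcup_j ker_pow m V z j.

Definition has_dim (R : realType) (S : set (fourier R)) (d : nat) : Prop :=
  exists b : 'I_d -> fourier R,
    (forall c : 'I_d -> R[i],
       (fun k => \sum_(i < d) c i * b i k) = (fun=> 0) -> forall i, c i = 0) /\
    S = [set f | exists c : 'I_d -> R[i],
                   f = (fun k => \sum_(i < d) c i * b i k)].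

(* The algebraic multiplicity of z is the dimension of its root space, which is
   0 when z is not an eigenvalue. *)
Definition alg_multiplicity (R : realType) (m : nat) (V : fourier R)
    (z : R[i]) (d : nat) : Prop :=
  has_dim (root_space m V z) d.

Record eigenvalue_enumeration (R : realType) (m : nat) (V : fourier R)
    (lam : nat -> R[i]) : Prop := EigenvalueEnumeration {
  enum_spectrum : spectrum m V = range lam;
  enum_eigenvalue : forall k, eigenvalue m V (lam k);
  enum_multiplicity : forall z, exists d : nat,
    alg_multiplicity m V z d /\ [set k | lam k = z] #= `I_d;
  enum_cvg : complex.Re (lam k) @[k --> \oo] --> +oo;
  enum_lex : forall k,
    complex.Re (lam k) < complex.Re (lam k.+1) \/
    complex.Re (lam k) = complex.Re (lam k.+1) /\
    complex.Im (lam k) <= complex.Im (lam k.+1)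
}.

Definition cone (R : realType) (m : nat) (M : R) (n0 : nat) : set R[i] :=
  [set z | `|complex.Im z| - M <= complex.Re z /\
    complex.Re z <= (n0%:R ^+ (2 * m) - n0%:R ^+ m) * pi ^+ (2 * m)].

(* Main.v *)
Require Import Defs.
From mathcomp Require Import all_boot all_order all_algebra.
From mathcomp Require Import all_classical all_reals all_analysis.
From mathcomp Require Import ring lra zify.
From mathcomp Require finmap.
Set Implicit Arguments.
Unset Strict Implicit.
Unset Printing Implicit Defensive.
Import Order.TTheory GRing.Theory Num.Theory.
Import numFieldNormedType.Exports.
Local Open Scope classical_set_scope.
Local Open Scope card_scope.
Local Open Scope complex_scope.
Local Open Scope ring_scope.

(** In Fourier coordinates [L] is the diagonal matrix of the numbers
    [eig k = (k pi)^(2 m)] plus the Toeplitz matrix [W (k - j)]. The proof works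
    with this infinite matrix directly; it replaces contour integrals and
    continuity of the spectrum by the explicit decoupling of invariant subspaces.

    For [z] away from the unperturbed spectrum let [s k = sqrt |eig k - z|] and
    [b k j = W (k - j) / (s k * s j)]. If [|eig k - z|] is at least half of [n^m]
    and of [||k|^(2 m) - n^(2 m)|] for all [k] (the predicate [sep n z]), the
    square of the Hilbert--Schmidt norm of [b] is at most a constant times the sum
    over [l] of [|W l|^2 <l>^(-2 m) c l], where [c] is bounded and, for fixed [l],
    tends to 0 as [n] grows. So this norm is at most 1/8 once [n] is large, and
    uniformly for [W] close to [V] in [H^(-m)] ([hs_small]). Every [z] outside the
    cone and outside the discs with [n >= n0] satisfies [sep p z] for some large
    [p] ([sep_right], [sep_left]), hence is not an eigenvalue
    ([no_eigenvalue]).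

    It remains to count. The line [Re z = gap n] lies between the discs with
    indices [n - 1] and [n], and its real point satisfies [sep] as well. For [k]
    below and [j] above this line the difference [eig j - eig k] is
    [s k ^ 2 + s j ^ 2], which makes the Riccati equation for an invariant
    subspace that is a graph over the coordinates [|k| < n] a contraction on
    Hilbert--Schmidt matrices ([riccati]). On this subspace [L] is a matrix [G] of
    size [2 n - 1] all of whose eigenvalues are left of the line, and modulo this
    subspace [L - z] is invertible for all [z] left of the line
    ([gap_decoupling], [sobolev_gap]). Therefore the part of the spectrum left of
    the line consists of the eigenvalues of [G], the root spaces of [L] are those
    of [G], and the algebraic multiplicities left of the line add up to [2 n - 1]
    ([sum_rank_geigenspace], [rank_multiplicity], [left_spectrum_exists]).

    For [n = n0] this is the count in the cone, as there are no eigenvalues left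
    of the cone. Comparing [n] with [n + 1], exactly
    two more eigenvalues lie between consecutive lines, and the only part of that
    strip that can contain eigenvalues is the disc with index [n]. The sorted lists
    of the eigenvalues left of each line extend one another, and their union is
    the lexicographic enumeration ([enumC]). *)

(** * The modulus as a real number *)

Section Modulus.
Variable R : realType.
Local Notation C := R[i].
Implicit Types (z w : C).

Definition nrm z : R := complex.Re `|z|.

Lemma nrmE z : (nrm z)%:C = `|z|.
Proof. by rewrite /nrm RRe_real. Qed.

Lemma nrm_ge0 z : 0 <= nrm z.
Proof. by rewrite -lecR nrmE; apply: normr_ge0. Qed.

Lemma nrm0 : nrm 0 = 0.
Proof. by rewrite /nrm normr0. Qed.

Lemma nrm0_eq0 z : nrm z = 0 -> z = 0.
Proof. by move=> h; apply/normr0_eq0; rewrite -nrmE h. Qed.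

Lemma nrmM z w : nrm (z * w) = nrm z * nrm w.
Proof. by apply: complexI; rewrite rmorphM/= !nrmE normrM. Qed.

Lemma nrmN z : nrm (- z) = nrm z.
Proof. by rewrite /nrm normrN. Qed.

Lemma nrmB z w : nrm (z - w) = nrm (w - z).
Proof. by rewrite /nrm distrC. Qed.

Lemma nrmV z : nrm z^-1 = (nrm z)^-1.
Proof. by apply: complexI; rewrite fmorphV/= !nrmE normfV. Qed.

Lemma nrm_real (x : R) : nrm x%:C = `|x|.
Proof. by apply: complexI; rewrite nrmE normc_def/= expr0n/= addr0 sqrtr_sqr. Qed.

Lemma nrmD z w : nrm (z + w) <= nrm z + nrm w.
Proof. by rewrite -lecR rmorphD/= !nrmE ler_normD. Qed.

Lemma nrm_sum (I : Type) (s : seq I) (P : pred I) (F : I -> C) :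
  nrm (\sum_(i <- s | P i) F i) <= \sum_(i <- s | P i) nrm (F i).
Proof.
elim/big_rec2: _ => [|i x y _ h]; first by rewrite nrm0.
by apply: le_trans (nrmD _ _) _; rewrite lerD2l.
Qed.

Lemma nrm_dist z w : `|nrm z - nrm w| <= nrm (z - w).
Proof.
have h a b : nrm a - nrm b <= nrm (a - b).
  by rewrite lerBlDr; apply: le_trans (nrmD _ _); rewrite subrK.
by rewrite ler_norml h lerNl opprB nrmB h.
Qed.

Lemma nrm_sqr z : nrm z ^+ 2 = complex.Re z ^+ 2 + complex.Im z ^+ 2.
Proof.
apply: complexI; rewrite add_Re2_Im2 -nrmE.
by rewrite rmorphXn.
Qed.

Lemma ReB z w : complex.Re (z - w) = complex.Re z - complex.Re w.
Proof. by case: z w => ? ? []. Qed.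

Lemma ImB z w : complex.Im (z - w) = complex.Im z - complex.Im w.
Proof. by case: z w => ? ? []. Qed.

Lemma Re_sum (I : Type) (s : seq I) (F : I -> C) :
  complex.Re (\sum_(i <- s) F i) = \sum_(i <- s) complex.Re (F i).
Proof. by elim/big_rec2: _ => // i x y _ <-; case: (F i) y => ? ? []. Qed.

Lemma Im_sum (I : Type) (s : seq I) (F : I -> C) :
  complex.Im (\sum_(i <- s) F i) = \sum_(i <- s) complex.Im (F i).
Proof. by elim/big_rec2: _ => // i x y _ <-; case: (F i) y => ? ? []. Qed.

Lemma Re_le_nrm z : `|complex.Re z| <= nrm z.
Proof.
rewrite -(@ler_pXn2r _ 2)// ?nnegrE ?nrm_ge0//.
by rewrite nrm_sqr real_normK ?num_real// lerDl sqr_ge0.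
Qed.

Lemma Im_le_nrm z : `|complex.Im z| <= nrm z.
Proof.
rewrite -(@ler_pXn2r _ 2)// ?nnegrE ?nrm_ge0//.
by rewrite nrm_sqr real_normK ?num_real// lerDr sqr_ge0.
Qed.

Lemma nrm_le_ReIm z : nrm z <= `|complex.Re z| + `|complex.Im z|.
Proof.
rewrite -(@ler_pXn2r _ 2)// ?nnegrE ?nrm_ge0 ?addr_ge0//.
rewrite nrm_sqr sqrrD !real_normK ?num_real// -addrA addrCA [leRHS]addrC lerDl.
by rewrite mulrn_wge0 ?mulr_ge0.
Qed.

End Modulus.

(** * Square-summable families *)

Section FiniteSums.
Variable R : realType.

Lemma sum_subset (I : eqType) (F : I -> R) (s t : seq I) :
  (forall i, 0 <= F i) -> uniq s -> {subset s <= t} ->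
  \sum_(i <- s) F i <= \sum_(i <- t) F i.
Proof.
move=> F0; elim: s t => [|x s IH] t /=; first by rewrite big_nil sumr_ge0.
case/andP=> xs us st; have xt : x \in t by apply: st; rewrite mem_head.
rewrite big_cons (big_rem x xt)/= lerD2l; apply: IH => // y ys.
apply: rem_mem; last by apply: st; rewrite inE ys orbT.
by apply: contraNneq xs => <-.
Qed.

Lemma cauchy_schwarz_seq (I : Type) (s : seq I) (a b : I -> R) :
  (\sum_(i <- s) a i * b i) ^+ 2 <=
  (\sum_(i <- s) a i ^+ 2) * (\sum_(i <- s) b i ^+ 2).
Proof.
elim: s => [|x s IH]; first by rewrite !big_nil expr0n/= mulr0.
rewrite !big_cons.
set S := \sum_(i <- s) _; set A := \sum_(i <- s) _; set B := \sum_(i <- s) _.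
rewrite -/S -/A -/B in IH.
have A0 : 0 <= A by apply: sumr_ge0 => i _; rewrite sqr_ge0.
have B0 : 0 <= B by apply: sumr_ge0 => i _; rewrite sqr_ge0.
move: (a x) (b x) => p q.
suff : 2 * S * p * q <= A * q ^+ 2 + B * p ^+ 2 by move: IH; nra.
have h0 : 0 <= A * q ^+ 2 + B * p ^+ 2.
  by rewrite addr_ge0// mulr_ge0// sqr_ge0.
apply: le_trans (ler_norm _) _.
rewrite -(@ler_pXn2r _ 2)// ?nnegrE// real_normK ?num_real//.
have h1 : (2 * S * p * q) ^+ 2 <= 4 * (A * B) * (p * q) ^+ 2.
  have -> : (2 * S * p * q) ^+ 2 = 4 * S ^+ 2 * (p * q) ^+ 2 by ring.
  by rewrite ler_wpM2r ?sqr_ge0// ler_pM2l.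
apply: le_trans h1 _.
rewrite -subr_ge0.
have -> : (A * q ^+ 2 + B * p ^+ 2) ^+ 2 - 4 * (A * B) * (p * q) ^+ 2 =
  (A * q ^+ 2 - B * p ^+ 2) ^+ 2 by ring.
exact: sqr_ge0.
Qed.

Lemma cvg_sum_seq (I : Type) (s : seq I) (u : I -> nat -> R) (l : I -> R) :
  (forall i, u i n @[n --> \oo] --> l i) ->
  \sum_(i <- s) u i n @[n --> \oo] --> \sum_(i <- s) l i.
Proof.
move=> ul; elim: s => [|x s IH].
  by under eq_fun do rewrite big_nil; rewrite big_nil; apply: cvg_cst.
by under eq_fun do rewrite big_cons; rewrite big_cons; apply: cvgD.
Qed.

End FiniteSums.

Section L2.
Variable R : realType.
Local Notation C := R[i].

(** The condition that the l^2 norm of [f] be at most [r], on finite partial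
    sums: every estimate then concerns finite real sums only, and a bound can be
    used before anything is known to converge. *)
Definition l2 (I : eqType) (f : I -> C) (r : R) : Prop :=
  0 <= r /\ forall s : seq I, uniq s -> \sum_(i <- s) nrm (f i) ^+ 2 <= r ^+ 2.

Variable I : eqType.
Implicit Types (f g : I -> C) (r q : R).

Lemma l2_ge0 f r : l2 f r -> 0 <= r. Proof. by case. Qed.

Lemma l2_pt f r i : l2 f r -> nrm (f i) <= r.
Proof.
case=> r0 /(_ [:: i] erefl); rewrite big_seq1.
by rewrite ler_pXn2r// nnegrE nrm_ge0.
Qed.

Lemma l2_dom f g r : (forall i, nrm (f i) <= nrm (g i)) -> l2 g r -> l2 f r.
Proof.
move=> fg [r0 h]; split=> // s us; apply: le_trans (h s us).
by apply: ler_sum => i _; rewrite lerXn2r// nnegrE nrm_ge0.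
Qed.

Lemma l2_mono f r q : l2 f r -> r <= q -> l2 f q.
Proof.
case=> r0 h rq; have q0 := le_trans r0 rq; split=> // s us.
by apply: le_trans (h s us) _; rewrite lerXn2r.
Qed.

Lemma l2_zero r : 0 <= r -> l2 (fun _ : I => 0) r.
Proof.
move=> r0; split=> // s _; rewrite big1 ?sqr_ge0// => i _.
by rewrite nrm0 expr0n.
Qed.

Lemma l2D f g r q : l2 f r -> l2 g q -> l2 (fun i => f i + g i) (r + q).
Proof.
case=> r0 hf [q0 hg]; split=> [|s us]; first exact: addr_ge0.
have := hg s us; have := hf s us.
set F := \sum_(i <- s) _; set G := \sum_(i <- s) _ => Fr Gq.
have G0 : 0 <= G by apply: sumr_ge0 => i _; rewrite sqr_ge0.
have F0 : 0 <= F by apply: sumr_ge0 => i _; rewrite sqr_ge0.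
have h : \sum_(i <- s) nrm (f i + g i) ^+ 2 <=
    F + G + 2 * \sum_(i <- s) nrm (f i) * nrm (g i).
  rewrite mulr_sumr -!big_split/=; apply: ler_sum => i _.
  have := nrmD (f i) (g i); have := nrm_ge0 (f i + g i).
  have := nrm_ge0 (f i); have := nrm_ge0 (g i).
  move: (nrm (f i + g i)) (nrm (f i)) (nrm (g i)) => c a b b0 a0 c0 cab.
  rewrite [leRHS](_ : _ = (a + b) ^+ 2); last by ring.
  by rewrite lerXn2r// nnegrE ?addr_ge0.
apply: le_trans h _.
have -> : (r + q) ^+ 2 = r ^+ 2 + q ^+ 2 + 2 * (r * q) by ring.
rewrite lerD ?lerD// ler_pM2l//.
rewrite -(@ler_pXn2r _ 2)// ?nnegrE ?mulr_ge0//; last first.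
  by apply: sumr_ge0 => i _; rewrite mulr_ge0// nrm_ge0.
apply: le_trans (cauchy_schwarz_seq s _ _) _.
by rewrite exprMn ler_pM.
Qed.

Lemma l2N f r : l2 f r -> l2 (fun i => - f i) r.
Proof. by apply: l2_dom => i; rewrite nrmN. Qed.

Lemma l2B f g r q : l2 f r -> l2 g q -> l2 (fun i => f i - g i) (r + q).
Proof. by move=> hf hg; apply: l2D => //; apply: l2N. Qed.

Lemma l2Z (c : C) f r : l2 f r -> l2 (fun i => c * f i) (nrm c * r).
Proof.
case=> r0 h; split=> [|s us]; first by rewrite mulr_ge0// nrm_ge0.
rewrite exprMn; under eq_bigr do rewrite nrmM exprMn.
by rewrite -mulr_sumr ler_wpM2l// ?sqr_ge0// h.
Qed.

Lemma l2_domZ (c : R) f g r : 0 <= c ->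
  (forall i, nrm (f i) <= c * nrm (g i)) -> l2 g r -> l2 f (c * r).
Proof.
move=> c0 fg hg; have := l2Z c%:C hg; rewrite nrm_real ger0_norm//.
by apply: l2_dom => i; rewrite nrmM nrm_real ger0_norm.
Qed.

Lemma l2_0_eq f : l2 f 0 -> f = (fun=> 0).
Proof.
move=> h; apply/funext => i; apply: nrm0_eq0; apply/eqP.
by rewrite eq_le (l2_pt _ h) nrm_ge0.
Qed.

(** A finite partial sum passes to the limit termwise; this replaces Fatou's
    lemma. *)
Lemma l2_lim (F : nat -> I -> C) f r :
  (forall n, l2 (F n) r) ->
  (forall i, nrm (F n i - f i) @[n --> \oo] --> (0 : R)) -> l2 f r.
Proof.
move=> hF Ff; split=> [|s us]; first exact: l2_ge0 (hF 0%N).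
have cF i : nrm (F n i) @[n --> \oo] --> nrm (f i).
  apply/subr_cvg0; apply: (@squeeze_cvgr _ _ _ _
    (fun n => - nrm (F n i - f i)) (fun n => nrm (F n i - f i))) => //.
    by apply: nearW => n; rewrite -ler_norml nrm_dist.
  by rewrite -oppr0; apply: cvgN.
have cS : \sum_(i <- s) nrm (F n i) ^+ 2 @[n --> \oo] -->
    \sum_(i <- s) nrm (f i) ^+ 2.
  by apply: cvg_sum_seq => i; rewrite expr2; apply: cvgM.
rewrite -(cvg_lim (@Rhausdorff R) cS); apply: limr_le.
  by apply/cvg_ex; eexists; exact: cS.
by apply: nearW => n; case: (hF n) => _; apply.
Qed.

Lemma l2_cvg_bound f (t : nat -> R) q :
  (forall n, l2 f (t n)) -> t n @[n --> \oo] --> q -> l2 f q.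
Proof.
move=> ft tq; split=> [|s us].
  rewrite -(cvg_lim (@Rhausdorff R) tq); apply: limr_ge.
    by apply/cvg_ex; eexists; exact: tq.
  by apply: nearW => n; exact: l2_ge0 (ft n).
have tq2 : t n ^+ 2 @[n --> \oo] --> q ^+ 2 by rewrite expr2; apply: cvgM.
rewrite -(cvg_lim (@Rhausdorff R) tq2); apply: limr_ge.
  by apply/cvg_ex; eexists; exact: tq2.
by apply: nearW => n; case: (ft n) => _; apply.
Qed.

(** The map [t |-> r + q t] contracts to its fixed point [r / (1 - q)]. With
    [r = 0] this is how a family is shown to vanish. *)
Lemma l2_self_improve f r q t0 : 0 <= q -> q < 1 -> l2 f t0 ->
  (forall t, l2 f t -> l2 f (r + q * t)) -> l2 f (r / (1 - q)).
Proof.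
move=> q0 q1 f0 h; have q1' : 1 - q != 0 by rewrite subr_eq0 gt_eqF.
pose t n := r / (1 - q) + (t0 - r / (1 - q)) * q ^+ n.
apply: (@l2_cvg_bound f t).
  elim=> [|n IH]; first by rewrite /t expr0 mulr1 addrC subrK.
  suff -> : t n.+1 = r + q * t n by exact: h.
  by rewrite /t exprS; field.
rewrite -[X in _ --> X]addr0 -(mulr0 (t0 - r / (1 - q))).
apply: cvgD; first exact: cvg_cst.
apply: cvgM; first exact: cvg_cst.
by apply: cvg_expr; rewrite ger0_norm.
Qed.

End L2.

(** * Absolutely convergent sums over the integers *)

Definition win (n : nat) : seq int := [seq j%:Z - n%:Z | j <- iota 0 n.*2.+1].

Section IntSum.
Variable R : realType.
Local Notation C := R[i].

Lemma win_uniq n : uniq (win n).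
Proof. by rewrite map_inj_uniq ?iota_uniq// => i j; lia. Qed.

Lemma mem_win n (k : int) : (k \in win n) = (`|k| <= n)%N.
Proof.
apply/mapP/idP => [[j]|h]; first by rewrite mem_iota => /andP[_ h] ->; lia.
by exists (absz (k + n%:Z)); rewrite ?mem_iota; lia.
Qed.

Lemma sub_win (s : seq int) : exists N, forall n, (N <= n)%N ->
  {subset s <= win n}.
Proof.
elim: s => [|x s [N IH]]; first by exists 0%N.
exists (maxn `|x| N) => n; rewrite geq_max => /andP[xn Nn] y.
by rewrite inE => /orP[/eqP ->|/(IH _ Nn)//]; rewrite mem_win.
Qed.

Lemma partE (A : zmodType) (u : int -> A) n :
  \sum_(j < n.*2.+1) u (j%:Z - n%:Z) = \sum_(j <- win n) u j.
Proof.
rewrite big_map -(big_mkord xpredT (fun j => u (j%:Z - n%:Z))).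
by rewrite /index_iota subn0.
Qed.

Lemma win_mono (w : int -> R) (K : R) : (forall i, 0 <= w i) ->
  (forall s, uniq s -> \sum_(i <- s) w i <= K) ->
  cvgn (fun n => \sum_(j <- win n) w j).
Proof.
move=> w0 wK; apply: nondecreasing_is_cvgn.
  move=> n p np; apply: sum_subset (win_uniq n) _ => // i.
  by rewrite !mem_win => /leq_trans; apply.
by exists K => _ [n _ <-]; apply: wK; apply: win_uniq.
Qed.

Lemma win_cvg (w : int -> R) (K : R) :
  (forall s, uniq s -> \sum_(i <- s) `|w i| <= K) ->
  cvgn (fun n => \sum_(j <- win n) w j).
Proof.
move=> wK.
have c1 : cvgn (fun n => \sum_(j <- win n) `|w j|) by exact: win_mono wK.
have c2 : cvgn (fun n => \sum_(j <- win n) (`|w j| + w j)).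
  apply: (@win_mono _ (K + K)) => [i|s us].
    by rewrite addrC -lerBlDr sub0r lerNl -normrN ler_norm.
  apply: le_trans (_ : \sum_(i <- s) (`|w i| + `|w i|) <= _).
    by apply: ler_sum => i _; rewrite lerD2l ler_norm.
  by rewrite big_split/= lerD ?wK.
have -> : (fun n => \sum_(j <- win n) w j) =
    (fun n => \sum_(j <- win n) (`|w j| + w j) - \sum_(j <- win n) `|w j|).
  by apply/funext => n; rewrite big_split/= addrAC subrr add0r.
exact: is_cvgB.
Qed.

Definition conv (u : int -> C) (l : C) : Prop :=
  nrm (\sum_(j <- win n) u j - l) @[n --> \oo] --> (0 : R).

Definition asum (u : int -> C) (K : R) : Prop :=
  forall s : seq int, uniq s -> \sum_(i <- s) nrm (u i) <= K.

Lemma cvg_Re (x : nat -> C) (l : C) : nrm (x n - l) @[n --> \oo] --> (0 : R) ->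
  complex.Re (x n) @[n --> \oo] --> complex.Re l.
Proof.
move=> xl; apply/subr_cvg0; apply: (@squeeze_cvgr _ _ _ _
  (fun n => - nrm (x n - l)) (fun n => nrm (x n - l))) => //; last first.
  by rewrite -oppr0; apply: cvgN.
apply: nearW => n; rewrite -ler_norml -ReB; exact: Re_le_nrm.
Qed.

Lemma cvg_Im (x : nat -> C) (l : C) : nrm (x n - l) @[n --> \oo] --> (0 : R) ->
  complex.Im (x n) @[n --> \oo] --> complex.Im l.
Proof.
move=> xl; apply/subr_cvg0; apply: (@squeeze_cvgr _ _ _ _
  (fun n => - nrm (x n - l)) (fun n => nrm (x n - l))) => //; last first.
  by rewrite -oppr0; apply: cvgN.
apply: nearW => n; rewrite -ler_norml -ImB; exact: Im_le_nrm.
Qed.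

Lemma cvg_nrm (x : nat -> C) (l : C) :
  complex.Re (x n) @[n --> \oo] --> complex.Re l ->
  complex.Im (x n) @[n --> \oo] --> complex.Im l ->
  nrm (x n - l) @[n --> \oo] --> (0 : R).
Proof.
move=> /subr_cvg0 hR /subr_cvg0 hI.
apply: (@squeeze_cvgr _ _ _ _ (fun=> 0)
  (fun n => `|complex.Re (x n) - complex.Re l| +
            `|complex.Im (x n) - complex.Im l|)).
- by apply: nearW => n; rewrite nrm_ge0/= -ReB -ImB; apply: nrm_le_ReIm.
- exact: cvg_cst.
- by rewrite -[0]addr0 -[X in X + _](normr0 R) -[X in _ + X](normr0 R);
    apply: cvgD; apply: cvg_norm.
Qed.

Lemma conv_int_sum u l : conv u l -> int_sum u = l.
Proof.
move=> ul; rewrite /int_sum.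
under [X in (lim (X @ _)) +i* _]eq_fun do rewrite partE.
under [X in _ +i* (lim (X @ _))]eq_fun do rewrite partE.
rewrite (cvg_lim (@Rhausdorff R) (cvg_Re ul)).
by rewrite (cvg_lim (@Rhausdorff R) (cvg_Im ul)); case: l {ul}.
Qed.

Lemma asum_conv u K : asum u K -> conv u (int_sum u).
Proof.
move=> uK.
have cR : cvgn (fun n => \sum_(j <- win n) complex.Re (u j)).
  apply: (@win_cvg _ K) => s us; apply: le_trans (uK s us).
  by apply: ler_sum => i _; apply: Re_le_nrm.
have cI : cvgn (fun n => \sum_(j <- win n) complex.Im (u j)).
  apply: (@win_cvg _ K) => s us; apply: le_trans (uK s us).
  by apply: ler_sum => i _; apply: Im_le_nrm.
have eR n : complex.Re (\sum_(j <- win n) u j) = \sum_(j <- win n) complex.Re (u j).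
  exact: Re_sum.
have eI n : complex.Im (\sum_(j <- win n) u j) = \sum_(j <- win n) complex.Im (u j).
  exact: Im_sum.
apply: cvg_nrm; rewrite /int_sum/=.
  under [X in _ --> (lim (X @ _))]eq_fun do rewrite partE.
  by rewrite (funext eR).
under [X in _ --> (lim (X @ _))]eq_fun do rewrite partE.
by rewrite (funext eI).
Qed.

Lemma convD u v l p : conv u l -> conv v p -> conv (fun i => u i + v i) (l + p).
Proof.
move=> hu hv; apply: (@squeeze_cvgr _ _ _ _ (fun=> 0)
  (fun n => nrm (\sum_(j <- win n) u j - l) +
            nrm (\sum_(j <- win n) v j - p))).
- apply: nearW => n; rewrite nrm_ge0/= big_split/= opprD addrACA.
  exact: nrmD.
- exact: cvg_cst.
- rewrite -[X in _ --> X]addr0.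
  exact: (cvgD (hu : _ --> _) (hv : _ --> _)).
Qed.

Lemma convZ c u l : conv u l -> conv (fun i => c * u i) (c * l).
Proof.
move=> hu; rewrite /conv; under eq_fun do rewrite -mulr_sumr -mulrBr nrmM.
by rewrite -(mulr0 (nrm c)); apply: cvgM => //; apply: cvg_cst.
Qed.

Lemma conv_fin (s : seq int) (u : int -> C) : uniq s -> (forall i, i \notin s -> u i = 0) ->
  conv u (\sum_(i <- s) u i).
Proof.
move=> us u0; have [N hN] := sub_win s.
apply: cvg_near_cst; exists N => // n /= /hN sn.
suff -> : \sum_(j <- win n) u j = \sum_(j <- s) u j by rewrite subrr nrm0.
rewrite (bigID (mem s))/= [X in _ + X]big1 ?addr0//.
rewrite -big_filter; apply: perm_big; apply: uniq_perm => //.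
  by rewrite filter_uniq// win_uniq.
move=> i; rewrite mem_filter/= andb_idr//; exact: sn.
Qed.

Lemma int_sum_fin (s : seq int) (u : int -> C) : uniq s ->
  (forall i, i \notin s -> u i = 0) -> int_sum u = \sum_(i <- s) u i.
Proof. by move=> us u0; apply/conv_int_sum/conv_fin. Qed.

Lemma int_sumD u v K K' : asum u K -> asum v K' ->
  int_sum (fun i => u i + v i) = int_sum u + int_sum v.
Proof. by move=> hu hv; apply/conv_int_sum/convD; apply: asum_conv; eauto. Qed.

Lemma int_sumZ c u K : asum u K -> int_sum (fun i => c * u i) = c * int_sum u.
Proof. by move=> hu; apply/conv_int_sum/convZ; apply: asum_conv hu. Qed.

Lemma int_sumB u v K K' : asum u K -> asum v K' ->
  int_sum (fun i => u i - v i) = int_sum u - int_sum v.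
Proof.
move=> hu hv; apply/conv_int_sum.
under eq_fun do rewrite -mulN1r.
by rewrite -[- int_sum v]mulN1r; apply: convD; [|apply: convZ];
  apply: asum_conv; eauto.
Qed.

Lemma eq_asum (u v : int -> C) K : (forall i, u i = v i) -> asum u K -> asum v K.
Proof. by move=> /funext ->. Qed.

(** Cauchy--Schwarz. All the infinite sums below, in particular those that
    define the product of [V] in [H^(-m)] with [f] in [H^m], are of this kind
    after rescaling. *)
Lemma l2_asum (f g : int -> C) (r q : R) : l2 f r -> l2 g q -> asum (fun i => f i * g i) (r * q).
Proof.
move=> [r0 hf] [q0 hg] s us; under eq_bigr do rewrite nrmM.
rewrite -(@ler_pXn2r _ 2)// ?nnegrE ?mulr_ge0//; last first.
  by apply: sumr_ge0 => i _; rewrite mulr_ge0// nrm_ge0.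
apply: le_trans (cauchy_schwarz_seq s _ _) _.
rewrite exprMn ler_pM ?hf ?hg//.
all: by apply: sumr_ge0 => i _; rewrite sqr_ge0.
Qed.

End IntSum.

(** * Hilbert--Schmidt matrices *)

Section HilbertSchmidt.
Variable R : realType.
Local Notation C := R[i].
Variable J : eqType.
Implicit Types (a : int -> int -> C) (g h : int -> J -> C).

Lemma uniq_pairs (A B : eqType) (s : seq A) (t : seq B) : uniq s -> uniq t ->
  uniq [seq (x, y) | x <- s, y <- t].
Proof. by move=> us ut; apply: allpairs_uniq => // -[? ?] [? ?]. Qed.

Definition hs (J : eqType) (g : int -> J -> C) (r : R) : Prop :=
  l2 (fun kj : int * J => g kj.1 kj.2) r.

Definition mm (J : Type) (a : int -> int -> C) (g : int -> J -> C) :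
    int -> J -> C :=
  fun k j => int_sum (fun p => a k p * g p j).

Lemma hs_row g r k : hs g r -> l2 (g k) r.
Proof.
case=> r0 h; split=> // s us; have := h [seq (k, j) | j <- s].
rewrite big_map/=; apply; rewrite map_inj_uniq// => i j; by case.
Qed.

Lemma hs_col g r j : hs g r -> l2 (fun k => g k j) r.
Proof.
case=> r0 h; split=> // s us; have := h [seq (k, j) | k <- s].
rewrite big_map/=; apply; rewrite map_inj_uniq// => i i'; by case.
Qed.

End HilbertSchmidt.

Section Products.
Variable R : realType.
Local Notation C := R[i].
Variable J : eqType.
Implicit Types (a : int -> int -> C) (g h : int -> J -> C).

Lemma hs_asum a g r q k j : hs a r -> hs g q ->
  asum (fun p => a k p * g p j) (r * q).
Proof. by move=> ha hg; apply: l2_asum; [exact: hs_row|exact: hs_col]. Qed.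

Lemma mmDr a g h r q t : hs a r -> hs g q -> hs h t ->
  mm a (fun k j => g k j + h k j) = fun k j => mm a g k j + mm a h k j.
Proof.
move=> ha hg hh; apply/funext => k; apply/funext => j.
rewrite /mm -(int_sumD (hs_asum k j ha hg) (hs_asum k j ha hh)).
by congr int_sum; apply/funext => p; rewrite mulrDr.
Qed.

Lemma mmBr a g h r q t : hs a r -> hs g q -> hs h t ->
  mm a (fun k j => g k j - h k j) = fun k j => mm a g k j - mm a h k j.
Proof.
move=> ha hg hh; apply/funext => k; apply/funext => j.
rewrite /mm -(int_sumB (hs_asum k j ha hg) (hs_asum k j ha hh)).
by congr int_sum; apply/funext => p; rewrite mulrBr.
Qed.

Lemma mmBl a a' g r q t : hs a r -> hs a' q -> hs g t ->
  mm (fun k j => a k j - a' k j) g = fun k j => mm a g k j - mm a' g k j.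
Proof.
move=> ha ha' hg; apply/funext => k; apply/funext => j.
rewrite /mm -(int_sumB (hs_asum k j ha hg) (hs_asum k j ha' hg)).
by congr int_sum; apply/funext => p; rewrite mulrBl.
Qed.

(** Truncating the inner sum leaves Cauchy--Schwarz for each row and each
    column; the bound then passes to the limit. *)
Lemma hs_mm a g r q : hs a r -> hs g q -> hs (mm a g) (r * q).
Proof.
move=> ha hg; have [r0 ha'] := ha; have [q0 hg'] := hg.
pose F n (kj : int * J) := \sum_(p <- win n) a kj.1 p * g p kj.2.
apply: (@l2_lim _ _ F) => [n|[k j]]; last first.
  exact: asum_conv (hs_asum k j ha hg).
split=> [|s us]; first exact: mulr_ge0.
pose A k := \sum_(p <- win n) nrm (a k p) ^+ 2.
pose G j := \sum_(p <- win n) nrm (g p j) ^+ 2.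
have A0 k : 0 <= A k by apply: sumr_ge0 => i _; rewrite sqr_ge0.
have G0 j : 0 <= G j by apply: sumr_ge0 => i _; rewrite sqr_ge0.
pose K := undup [seq x.1 | x <- s]; pose L := undup [seq x.2 | x <- s].
apply: le_trans (_ : \sum_(x <- s) A x.1 * G x.2 <= _).
  apply: ler_sum => -[k j] _; apply: le_trans (cauchy_schwarz_seq _ _ _).
  rewrite lerXn2r// ?nnegrE ?nrm_ge0//.
    by apply: sumr_ge0 => i _; rewrite mulr_ge0// nrm_ge0.
  apply: le_trans (nrm_sum _ _ _) _.
  by apply: ler_sum => p _; rewrite nrmM.
apply: le_trans (_ : \sum_(x <- [seq (k, j) | k <- K, j <- L]) A x.1 * G x.2 <= _).
  apply: sum_subset => // [x|[k j] ks]; first exact: mulr_ge0.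
  by apply/allpairsP; exists (k, j); rewrite !mem_undup; split=> //;
    apply/mapP; exists (k, j).
rewrite big_allpairs/=.
under eq_bigr do rewrite -mulr_sumr.
rewrite -mulr_suml exprMn ler_pM//; try exact: sumr_ge0.
- rewrite /A; have := ha' [seq (k, p) | k <- K, p <- win n].
  rewrite big_allpairs; apply; apply: uniq_pairs; rewrite ?undup_uniq ?win_uniq//.
- rewrite /G exchange_big/=.
  have := hg' [seq (p, j) | p <- win n, j <- L].
  rewrite big_allpairs; apply; apply: uniq_pairs; rewrite ?undup_uniq ?win_uniq//.
Qed.

End Products.

Section MatrixVector.
Variable R : realType.
Local Notation C := R[i].
Implicit Types (a : int -> int -> C) (f g : int -> C).

Definition mv a f : int -> C := fun k => int_sum (fun p => a k p * f p).

Lemma hs_vec f r : l2 f r -> hs (fun k (_ : unit) => f k) r.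
Proof.
case=> r0 h; split=> // s us; rewrite -(big_map fst xpredT (fun k => nrm (f k) ^+ 2)).
apply: h; rewrite map_inj_uniq// => -[? []] [? []] /= -> //.
Qed.

Lemma l2_mv a f r q : hs a r -> l2 f q -> l2 (mv a f) (r * q).
Proof. by move=> ha hf; apply: hs_col tt (hs_mm ha (hs_vec hf)). Qed.

Lemma mvD a f g r q t : hs a r -> l2 f q -> l2 g t ->
  mv a (fun k => f k + g k) = fun k => mv a f k + mv a g k.
Proof.
move=> ha hf hg; have := mmDr ha (hs_vec hf) (hs_vec hg).
by move=> h; apply/funext => k; have := congr1 (fun F => F k tt) h.
Qed.

Lemma mvB a f g r q t : hs a r -> l2 f q -> l2 g t ->
  mv a (fun k => f k - g k) = fun k => mv a f k - mv a g k.
Proof.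
move=> ha hf hg; have := mmBr ha (hs_vec hf) (hs_vec hg).
by move=> h; apply/funext => k; have := congr1 (fun F => F k tt) h.
Qed.

End MatrixVector.

(** * The contraction principle in l^2 *)

Section Contraction.
Variable R : realType.
Local Notation C := R[i].

Lemma cauchy_nrm (x : nat -> C) (r q : R) : 0 <= q -> q < 1 ->
  (forall n, nrm (x n.+1 - x n) <= r * q ^+ n) ->
  exists l, nrm (x n - l) @[n --> \oo] --> (0 : R).
Proof.
move=> q0 q1 hx.
have cg : cvgn (series (geometric r q)).
  by apply: is_cvg_geometric_series; rewrite ger0_norm.
have H (f : C -> R) : (forall z w, f (z - w) = f z - f w) ->
    (forall z, `|f z| <= nrm z) -> cvgn (fun n => f (x n)).
  move=> fB fn.
  have cf : cvgn (series (fun n => f (x n.+1) - f (x n))).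
    apply: normed_cvg; apply: series_le_cvg cg => n.
    - exact: normr_ge0.
    - by rewrite /geometric/=; apply: le_trans (hx n); apply: le_trans (nrm_ge0 _) _.
    - by rewrite /= -fB; apply: le_trans (fn _) (hx n).
  have -> : (fun n => f (x n)) =
      (fun n => f (x 0%N) + series (fun n => f (x n.+1) - f (x n)) n).
    apply/funext => n; rewrite /series/= telescope_sumr//.
    by rewrite addrC subrK.
  by apply: is_cvgD => //; apply: is_cvg_cst.
exists (lim (complex.Re (x n) @[n --> \oo]) +i* lim (complex.Im (x n) @[n --> \oo])).
apply: cvg_nrm => /=.
  by apply: H; [exact: ReB|exact: Re_le_nrm].
by apply: H; [exact: ImB|exact: Im_le_nrm].
Qed.

Variable I : eqType.

(** Completeness of l^2 enters only here: the iterates converge entrywise, and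
    balls are closed under entrywise limits. *)
Theorem l2_fixpoint (F : (I -> C) -> I -> C) (r q : R) :
  0 <= r -> 0 <= q -> q < 1 ->
  (forall x, l2 x r -> l2 (F x) r) ->
  (forall x y t, l2 x r -> l2 y r -> l2 (fun i => x i - y i) t ->
    l2 (fun i => F x i - F y i) (q * t)) ->
  exists2 x, l2 x r & F x = x.
Proof.
move=> r0 q0 q1 Fr Fq.
pose X := fix X n := if n is n'.+1 then F (X n') else fun=> (0 : C).
have Xr n : l2 (X n) r by elim: n => [|n IH]; [exact: l2_zero|exact: Fr].
have dX n p : l2 (fun i => X (n + p)%N i - X n i) ((r + r) * q ^+ n).
  elim: n => [|n IH]; first by rewrite add0n expr0 mulr1; apply: l2B.
  by rewrite exprS mulrCA addSn; apply: Fq.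
have [x xP] : exists x, forall i, nrm (X n i - x i) @[n --> \oo] --> (0 : R).
  suff /choice[x xP] : forall i, exists l, nrm (X n i - l) @[n --> \oo] --> (0 : R).
    by exists x.
  move=> i; apply: (@cauchy_nrm _ (r + r) q) => // n.
  by have := l2_pt i (dX n 1%N); rewrite addn1.
have xr : l2 x r by apply: l2_lim xP.
exists x => //.
have dx n : l2 (fun i => x i - X n i) ((r + r) * q ^+ n).
  apply: (@l2_lim _ _ (fun p i => X (n + p)%N i - X n i)) => // i.
  rewrite (_ : (fun p => _) = (fun p => nrm (X (p + n)%N i - x i))).
    by have := xP i; rewrite -(cvg_shiftn n).
  by apply/funext => p; congr nrm; rewrite addnC; ring.
have := cvg_expr (_ : `|q| < 1); rewrite ger0_norm// => /(_ q1) cq.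
suff : l2 (fun i => F x i - x i) 0.
  by move/l2_0_eq => h; apply/funext => i; apply/eqP;
    rewrite -subr_eq0; have := congr1 (fun f => f i) h => /= ->.
apply: (@l2_cvg_bound _ _ _ (fun n => (q + q) * ((r + r) * q ^+ n))).
  move=> n; have h1 := Fq _ _ _ xr (Xr n) (dx n).
  have h2 := dx n.+1; rewrite exprS in h2.
  have -> : (q + q) * ((r + r) * q ^+ n) =
    q * ((r + r) * q ^+ n) + (r + r) * (q * q ^+ n) by ring.
  by have := l2B h1 h2; apply: l2_dom => i /=; rewrite opprB addrA subrK.
rewrite -(mulr0 (q + q)) -(mulr0 (r + r)).
apply: cvgM; first exact: cvg_cst.
by apply: cvgM => //; exact: cvg_cst.
Qed.

End Contraction.

(** * Decoupling a diagonal operator across a spectral gap *)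

Definition opL (R : realType) (lam : int -> R) (B : int -> int -> R[i])
    (f : int -> R[i]) : int -> R[i] :=
  fun k => (lam k)%:C * f k + mv B f k.

Definition lincomb (R : realType) (n : nat) (u : 'I_n -> int -> R[i])
    (a : 'rV[R[i]]_n) : int -> R[i] :=
  fun k => \sum_i a 0 i * u i k.

Lemma subBB (A : zmodType) (x y z t : A) : x - y - (z - t) = x - z - (y - t).
Proof. by rewrite !opprB addrACA [in RHS]addrACA [- y + _]addrC. Qed.

Section Gap.
Variable R : realType.
Local Notation C := R[i].
Variables (lam : int -> R) (B : int -> int -> C) (z0 : R) (N : nat).

Let P (k : int) := (absz k <= N)%N.
Let d k : R := `|lam k - z0|.
Let sc k : C := (Num.sqrt (d k))%:C.

Hypothesis lam_lo : forall k, P k -> lam k < z0.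
Hypothesis lam_hi : forall k, ~~ P k -> z0 < lam k.

Let b k j : C := B k j / (sc k * sc j).

Hypothesis hb : hs b 8^-1.

Lemma gap_d_gt0 k : 0 < d k.
Proof.
rewrite normr_gt0 subr_eq0; have [/lam_lo|/lam_hi] := boolP (P k).
  by move=> h; rewrite lt_eqF.
by move=> h; rewrite gt_eqF.
Qed.
Let d_gt0 := gap_d_gt0.

Lemma gap_sc_neq0 k : sc k != 0.
Proof. by rewrite /sc eq_complex/= eqxx andbT gt_eqF// sqrtr_gt0. Qed.
Let sc_neq0 := gap_sc_neq0.

Lemma gap_scM k : sc k * sc k = (d k)%:C.
Proof. by rewrite -rmorphM/= -expr2 sqr_sqrtr// ltW. Qed.
Let scM := gap_scM.

Lemma gap_dC_neq0 k : (d k)%:C != 0.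
Proof. by rewrite -scM mulf_neq0. Qed.
Let dC_neq0 := gap_dC_neq0.

(** For [A] diagonal with entries [lam], the equation [A Z - Z A = X] has the
    solution [X k j / (lam k - lam j)]. For [k] and [j] on opposite sides of the gap
    [|lam k - lam j| = d k + d j], so that in the coordinates scaled by
    [sqrt d] the solution is [x], multiplied entrywise by [zw k j] or by
    [zw j k] according to the side on which the scaling is put. Both factors are
    at most 1. *)
Definition zw k j : C := (d k / (d k + d j))%:C.

Lemma zw_le1 k j : nrm (zw k j) <= 1.
Proof.
have dk := d_gt0 k; have dj := d_gt0 j.
rewrite nrm_real ger0_norm ?divr_ge0 ?addr_ge0 ?ltW//.
by rewrite ltr_pdivrMr ?addr_gt0// mul1r ltrDl.
Qed.

Definition zl (x : int -> int -> C) k j := zw k j * x k j.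
Definition zr (x : int -> int -> C) k j := zw j k * x k j.

Lemma hs_zl x r : hs x r -> hs (zl x) r.
Proof.
apply: l2_dom => -[k j] /=.
by rewrite nrmM ler_piMl ?nrm_ge0// zw_le1.
Qed.

Lemma hs_zr x r : hs x r -> hs (zr x) r.
Proof.
apply: l2_dom => -[k j] /=.
by rewrite nrmM ler_piMl ?nrm_ge0// zw_le1.
Qed.

Definition bz x : int -> int -> C := fun k j => b k j + mm b (zl x) k j.

Lemma hs_bz x : hs x 2^-1 -> hs (bz x) (3 / 16).
Proof.
by move=> hx; apply: (l2_mono (l2D hb (hs_mm hb (hs_zl hx)))); lra.
Qed.

Lemma zlB x y : zl (fun k j => x k j - y k j) = fun k j => zl x k j - zl y k j.
Proof. by apply/funext => k; apply/funext => j; rewrite /zl mulrBr. Qed.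

Lemma zrB x y : zr (fun k j => x k j - y k j) = fun k j => zr x k j - zr y k j.
Proof. by apply/funext => k; apply/funext => j; rewrite /zr mulrBr. Qed.

(** The subspace [{f + Z f}], with [f] supported below the gap and [Z f] above
    it, is invariant iff [Z] solves a quadratic equation. In the unknown [x] the
    right-hand side maps the ball of radius 1/2 into itself, because
    [(1/8) (1 + 1/2)^2 <= 1/2], and is Lipschitz there with constant [3/8]. *)
Lemma riccati : exists2 x : int -> int -> C, hs x 2^-1 &
  forall k j, x k j =
    if ~~ P k && P j then mm (zr x) (bz x) k j - bz x k j else 0.
Proof.
pose F (X : int * int -> C) (kj : int * int) : C :=
  let x k j := X (k, j) in
  if ~~ P kj.1 && P kj.2 then mm (zr x) (bz x) kj.1 kj.2 - bz x kj.1 kj.2 else 0.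
have toX (X : int * int -> C) r : l2 X r -> hs (fun k j => X (k, j)) r.
  by apply: l2_dom => -[].
have FP (X : int * int -> C) (g : int -> int -> C) r : hs g r ->
    (forall k j, F X (k, j) = if ~~ P k && P j then g k j else 0) -> l2 (F X) r.
  move=> hg e; apply: l2_dom hg => -[k j]; rewrite e/=.
  by case: ifP => // _; rewrite nrm0 nrm_ge0.
have FT X k j : ~~ P k && P j -> F X (k, j) =
    mm (zr (fun k j => X (k, j))) (bz (fun k j => X (k, j))) k j -
    bz (fun k j => X (k, j)) k j by rewrite /F/= => ->.
have FF X k j : ~~ (~~ P k && P j) -> F X (k, j) = 0.
  by rewrite /F/= => /negbTE ->.
have r0 : 0 <= 2^-1 :> R by lra.
have q0 : 0 <= 3 / 8 :> R by lra.
have q1 : 3 / 8 < 1 :> R by lra.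
have [||X hX FX] := @l2_fixpoint R _ F _ _ r0 q0 q1.
- move=> X /toX hX; apply: (@l2_mono _ _ _ (2^-1 * (3 / 16) + 3 / 16)); last lra.
  apply: FP => [|k j]; last by [].
  exact: l2B (hs_mm (hs_zr hX) (hs_bz hX)) (hs_bz hX).
- move=> X Y t /toX hX /toX hY /toX hXY.
  set x := fun k j => X (k, j); set y := fun k j => Y (k, j).
  have hx : hs x 2^-1 by []. have hy : hs y 2^-1 by [].
  have bB : (fun k j => bz x k j - bz y k j) =
      mm b (zl (fun k j => x k j - y k j)).
    rewrite zlB (mmBr hb (hs_zl hx) (hs_zl hy)).
    by apply/funext => k; apply/funext => j; rewrite /bz; ring.
  have hbB : hs (fun k j => bz x k j - bz y k j) (8^-1 * t).
    by rewrite bB; apply: hs_mm hb _; apply: hs_zl.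
  have mB : (fun k j => mm (zr x) (bz x) k j - mm (zr y) (bz y) k j) =
      fun k j => mm (zr (fun k j => x k j - y k j)) (bz x) k j +
                 mm (zr y) (fun k j => bz x k j - bz y k j) k j.
    rewrite zrB (mmBl (hs_zr hx) (hs_zr hy) (hs_bz hx)).
    rewrite (mmBr (hs_zr hy) (hs_bz hx) (hs_bz hy)).
    by apply/funext => k; apply/funext => j; rewrite addrA subrK.
  have hm : hs (fun k j => mm (zr x) (bz x) k j - mm (zr y) (bz y) k j)
      (t * (3 / 16) + 2^-1 * (8^-1 * t)).
    rewrite mB; apply: l2D; apply: hs_mm => //.
    - exact: hs_zr.
    - exact: hs_bz.
    - exact: hs_zr.
  have -> : 3 / 8 * t = t * (3 / 16) + 2^-1 * (8^-1 * t) + 8^-1 * t by lra.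
  apply: l2_dom (l2B hm hbB) => -[k j].
  have [PQ|PQ] := boolP (~~ P k && P j); last first.
    by rewrite !FF// subrr nrm0 nrm_ge0.
  by rewrite !FT// -/x -/y /= subBB.
- exists (fun k j => X (k, j)); first exact: toX.
  by move=> k j; rewrite -[in LHS]FX.
Qed.

(** The form domain of the diagonal operator; for the powers [(k pi)^(2 m)] it
    is [H^m]. *)
Definition dom (f : int -> C) := exists r, l2 (fun k => sc k * f k) r.

Lemma domD f g : dom f -> dom g -> dom (fun k => f k + g k).
Proof.
move=> [r hf] [q hg]; exists (r + q).
by apply: l2_dom (l2D hf hg) => k; rewrite mulrDr.
Qed.

Lemma domZ a f : dom f -> dom (fun k => a * f k).
Proof.
move=> [r hf]; exists (nrm a * r).
by apply: l2_dom (l2Z a hf) => k; rewrite mulrCA.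
Qed.

Lemma domB f g : dom f -> dom g -> dom (fun k => f k - g k).
Proof.
move=> hf hg; have := domD hf (domZ (-1) hg).
by under eq_fun do rewrite mulN1r.
Qed.

Lemma dom_sum (J : Type) (s : seq J) (f : J -> int -> C) :
  (forall j, dom (f j)) -> dom (fun k => \sum_(j <- s) f j k).
Proof.
move=> hf; elim: s => [|x s IH].
  by exists 0; apply: l2_dom (l2_zero _ (lexx 0)) => k; rewrite big_nil mulr0.
by under eq_fun do rewrite big_cons; apply: domD.
Qed.

Lemma mvB_asum f k : dom f -> exists K, asum (fun p => B k p * f p) K.
Proof.
move=> [r hf]; exists (nrm (sc k) * 8^-1 * r).
have := l2_asum (l2Z (sc k) (hs_row k hb)) hf; apply: eq_asum => p.
by rewrite /b; field; rewrite !sc_neq0.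
Qed.

Lemma mvB_scaled f : dom f ->
  mv B f = fun k => sc k * mv b (fun k => sc k * f k) k.
Proof.
move=> [r hf]; apply/funext => k.
rewrite /mv -(int_sumZ _ (l2_asum (hs_row k hb) hf)).
congr int_sum; apply/funext => p.
by rewrite /b; field; rewrite !sc_neq0.
Qed.

Local Notation L := (opL lam B).

Lemma opLD f g : dom f -> dom g -> L (fun k => f k + g k) = fun k => L f k + L g k.
Proof.
move=> hf hg; apply/funext => k; rewrite /opL /mv.
have [K hK] := mvB_asum k hf; have [K' hK'] := mvB_asum k hg.
under [in LHS]eq_fun do rewrite mulrDr.
by rewrite (int_sumD hK hK') mulrDr; ring.
Qed.

Lemma opLZ a f : dom f -> L (fun k => a * f k) = fun k => a * L f k.
Proof.
move=> hf; apply/funext => k; rewrite /opL /mv.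
have [K hK] := mvB_asum k hf.
under [in LHS]eq_fun do rewrite mulrCA.
by rewrite (int_sumZ _ hK) mulrDr; ring.
Qed.

Lemma opL_sum (J : Type) (s : seq J) (f : J -> int -> C) :
  (forall j, dom (f j)) ->
  L (fun k => \sum_(j <- s) f j k) = fun k => \sum_(j <- s) L (f j) k.
Proof.
move=> hf; elim: s => [|x s IH]; apply/funext => k.
  under eq_fun do rewrite big_nil.
  rewrite big_nil /opL /mv mulr0 add0r.
  by rewrite (@int_sum_fin _ [::]) ?big_nil// => i _; rewrite mulr0.
under eq_fun do rewrite big_cons.
by rewrite opLD//; [rewrite IH big_cons|exact: dom_sum].
Qed.

Section AngularOperator.
Variable x : int -> int -> C.
Hypothesis hx : hs x 2^-1.
Hypothesis xE : forall k j, x k j =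
    if ~~ P k && P j then mm (zr x) (bz x) k j - bz x k j else 0.

Let c := bz x.
Let Z k j := zl x k j * sc j / sc k.

Lemma hs_c : hs c (3 / 16). Proof. exact: hs_bz. Qed.

Lemma Z_supp k j : P k || ~~ P j -> Z k j = 0.
Proof.
move=> h; rewrite /Z /zl xE ifN; first by rewrite mulr0 !mul0r.
by rewrite negb_and negbK.
Qed.

Lemma zr_supp k j : P k || ~~ P j -> zr x k j = 0.
Proof.
by move=> h; rewrite /zr xE ifN; rewrite ?mulr0// negb_and negbK.
Qed.

Lemma sc_Z k j : sc k * Z k j = zl x k j * sc j.
Proof. by rewrite /Z mulrC divfK. Qed.

Lemma dD_neq0 k j : (d k)%:C + (d j)%:C != 0.
Proof.
by rewrite -rmorphD/= eq_complex/= eqxx andbT gt_eqF// addr_gt0.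
Qed.

Lemma sc_zr k j : sc k * zr x k j = Z k j * sc j.
Proof.
rewrite /zr /Z /zl /zw !fmorph_div/= !rmorphD/= -!scM.
by field; rewrite sc_neq0 addrC !scM !dD_neq0.
Qed.

Lemma sc_x k j : ~~ P k -> P j ->
  sc k * x k j * sc j = (lam k - lam j)%:C * Z k j.
Proof.
move=> Pk Pj; have -> : lam k - lam j = d k + d j.
  rewrite /d gtr0_norm ?subr_gt0 ?lam_hi// ltr0_norm ?subr_lt0 ?lam_lo//; ring.
rewrite /Z /zl /zw !fmorph_div/= !rmorphD/= -!scM.
by field; rewrite sc_neq0 !scM dD_neq0.
Qed.

Local Notation n := N.*2.+1.
Definition idx (i : 'I_n) : int := i%:Z - N%:Z.

Lemma P_idx i : P (idx i).
Proof. by rewrite /P /idx; have := ltn_ord i; lia. Qed.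

Lemma idx_inj : injective idx.
Proof. by move=> i j; rewrite /idx => h; apply: val_inj => /=; lia. Qed.

Lemma idxP k : P k -> exists i, k = idx i.
Proof.
rewrite /P => h; have hi : (absz (k + N%:Z)%R < n)%N by lia.
by exists (Ordinal hi); rewrite /idx/=; lia.
Qed.

Lemma int_sum_P (f : int -> C) : (forall p, ~~ P p -> f p = 0) ->
  int_sum f = \sum_i f (idx i).
Proof.
move=> f0; rewrite (int_sum_fin (win_uniq N)) ?partE//.
by move=> i; rewrite mem_win; apply: f0.
Qed.

(** The basis [e_i + Z e_i] of the graph of [Z], and its combinations *)
Definition gu i k : C := (k == idx i)%:R + Z k (idx i).
Definition gU (a : 'rV[C]_n) k : C := \sum_i a 0 i * gu i k.

Definition gG : 'M[C]_n := \matrix_(i, j)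
  ((i == j)%:R * (lam (idx i))%:C + sc (idx i) * sc (idx j) * c (idx j) (idx i)).

Lemma gu_idx i j : gu i (idx j) = (i == j)%:R.
Proof.
by rewrite /gu Z_supp ?P_idx// addr0 (inj_eq idx_inj) eq_sym.
Qed.

Lemma gu_notP i k : ~~ P k -> gu i k = Z k (idx i).
Proof.
move=> Pk; rewrite /gu (_ : (k == idx i) = false) ?add0r//.
by apply: contraNF Pk => /eqP ->; apply: P_idx.
Qed.

Lemma gU_idx a j : gU a (idx j) = a 0 j.
Proof.
rewrite /gU (bigD1 j)//= big1 ?addr0 => [|i ij]; rewrite gu_idx.
  by rewrite eqxx mulr1.
by rewrite (negbTE ij) mulr0.
Qed.

Lemma gU_notP a k : ~~ P k -> gU a k = \sum_i a 0 i * Z k (idx i).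
Proof. by move=> Pk; apply: eq_bigr => i _; rewrite gu_notP. Qed.

Lemma l2_delta (j : int) (a : C) : l2 (fun k => (k == j)%:R * a) (nrm a).
Proof.
split=> [|s us]; first exact: nrm_ge0.
rewrite (bigID (pred1 j))/= [X in _ + X]big1 => [|i /negbTE ->]; last first.
  by rewrite mul0r nrm0 expr0n.
rewrite addr0 -big_filter; have [js|js] := boolP (j \in s).
  by rewrite filter_pred1_uniq// big_seq1 eqxx mul1r.
rewrite big1_seq ?sqr_ge0// => i /andP[_]; rewrite mem_filter/= => /andP[/eqP ->].
by rewrite (negbTE js).
Qed.

Lemma sc_gu i k : sc k * gu i k =
  (k == idx i)%:R * sc (idx i) + sc (idx i) * zl x k (idx i).
Proof.
rewrite /gu mulrDr sc_Z [sc k * _]mulrC [zl _ _ _ * _]mulrC; congr (_ + _).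
by case: eqP => [->//|_]; rewrite !mul0r.
Qed.

Lemma l2_gu i : l2 (fun k => sc k * gu i k)
  (nrm (sc (idx i)) + nrm (sc (idx i)) * 2^-1).
Proof.
apply: l2_dom (l2D (l2_delta (idx i) (sc (idx i)))
  (l2Z (sc (idx i)) (hs_col (idx i) (hs_zl hx)))) => k.
by rewrite sc_gu.
Qed.

Lemma dom_gu i : dom (gu i).
Proof. by eexists; apply: l2_gu. Qed.

Lemma dom_gU a : dom (gU a).
Proof. by apply: dom_sum => i; apply/domZ/dom_gu. Qed.

Lemma opL_gu i k : L (gu i) k =
  (lam k)%:C * gu i k + sc k * (c k (idx i) * sc (idx i)).
Proof.
rewrite /opL (mvB_scaled (dom_gu i)); congr (_ + _ * _).
have h1 : l2 (fun p => (p == idx i)%:R * sc (idx i)) (nrm (sc (idx i))).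
  exact: l2_delta.
have h2 := l2Z (sc (idx i)) (hs_col (idx i) (hs_zl hx)).
under eq_fun do rewrite sc_gu.
rewrite (mvD hb h1 h2) /c /bz mulrDl; congr (_ + _).
  rewrite /mv (@int_sum_fin _ [:: idx i])// => [|p].
    by rewrite big_seq1 eqxx mul1r.
  by rewrite inE => /negbTE ->; rewrite mul0r mulr0.
rewrite /mv /mm mulrC.
rewrite -(int_sumZ _ (l2_asum (hs_row k hb) (hs_col (idx i) (hs_zl hx)))).
by congr int_sum; apply/funext => p; rewrite mulrCA.
Qed.

(** Below the gap this is the definition of [gG], above it the Riccati
    equation. *)
Lemma opL_gu_block i : L (gu i) = fun k => \sum_j gG i j * gu j k.
Proof.
apply/funext => k; rewrite opL_gu; have [Pk|Pk] := boolP (P k).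
  have [j ->] := idxP Pk; rewrite gu_idx (bigD1 j)//= big1 ?addr0 => [|l lj].
    rewrite gu_idx eqxx mulr1 mxE; case: eqP => [->|_] /=; rewrite ?mulr1n ?mulr0n; ring.
  by rewrite gu_idx (negbTE lj) mulr0.
under eq_bigr do rewrite gu_notP// mxE mulrDl.
rewrite big_split/= gu_notP// (bigD1 i)//= big1 ?addr0 => [|j ji]; last first.
  by rewrite eq_sym (negbTE ji) !mul0r.
rewrite eqxx mul1r.
have h := sc_x Pk (P_idx i).
rewrite xE Pk P_idx/= -/c in h.
have -> : (lam k)%:C * Z k (idx i) =
    (lam (idx i))%:C * Z k (idx i) + (lam k - lam (idx i))%:C * Z k (idx i).
  by rewrite rmorphB/=; ring.
rewrite -h -addrA; congr (_ + _).
rewrite /mm int_sum_P => [|p Pp]; last by rewrite zr_supp ?Pp ?orbT// mul0r.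
rewrite mulrBr mulrBl mulrA subrK mulr_sumr mulr_suml; apply: eq_bigr => j _.
by rewrite [sc k * _]mulrA sc_zr; ring.
Qed.

Definition shift z f k : C := L f k - z * f k.

Lemma shift_gU z a : shift z (gU a) = gU (a *m (gG - z%:M)).
Proof.
apply/funext => k; rewrite /shift /gU opL_sum => [|i]; last exact/domZ/dom_gu.
under eq_bigr do rewrite (opLZ _ (dom_gu _)) opL_gu_block.
rewrite mulmxBr mul_mx_scalar mulr_sumr -sumrB.
under [in RHS]eq_bigr do rewrite !mxE mulrBl mulr_suml.
rewrite !sumrB; congr (_ - _); last by apply: eq_bigr => i _; rewrite mulrA.
under eq_bigr do rewrite mulr_sumr.
rewrite exchange_big; apply: eq_bigr => j _; apply: eq_bigr => i _.
by rewrite mulrA.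
Qed.

Lemma shiftD z f g : dom f -> dom g ->
  shift z (fun k => f k + g k) = fun k => shift z f k + shift z g k.
Proof. by move=> hf hg; apply/funext => k; rewrite /shift opLD//; ring. Qed.

Definition supQ (f : int -> C) := forall k, P k -> f k = 0.

Definition cT om k : C := mv b om k - mv (zr x) (mv b om) k.

Lemma l2_T om r : l2 om r -> l2 (cT om) (3 / 16 * r).
Proof.
move=> h; have h1 := l2_mv hb h; have h2 := l2_mv (hs_zr hx) h1.
by apply: (l2_mono (l2B h1 h2)); lra.
Qed.

Lemma zr_mv (f : int -> C) k :
  mv (zr x) f k = \sum_i zr x k (idx i) * f (idx i).
Proof.
by rewrite /mv int_sum_P// => p Pp; rewrite zr_supp ?Pp ?orbT// mul0r.
Qed.

Lemma shift_idx z a w j : dom w -> supQ w ->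
  shift z (fun k => gU a k + w k) (idx j) =
  (a *m (gG - z%:M)) 0 j + mv B w (idx j).
Proof.
move=> dw w0; rewrite shiftD//; last exact: dom_gU.
by rewrite shift_gU gU_idx /shift /opL w0 ?P_idx// !mulr0 subr0 add0r.
Qed.

(** On the complementary component [w] the operator acts, modulo the invariant
    subspace, as a perturbation of the part of the diagonal above the gap. *)
Lemma shift_notP z a w k : dom w -> supQ w -> ~~ P k ->
  let g := shift z (fun k => gU a k + w k) in
  (((lam k)%:C - z) / (d k)%:C) * (sc k * w k) + cT (fun k => sc k * w k) k =
  g k / sc k - mv (zr x) (fun k => g k / sc k) k.
Proof.
move=> dw w0 Pk g.
have Bw j : mv b (fun k => sc k * w k) j = mv B w j / sc j.
  by rewrite mvB_scaled//= [sc j * _]mulrC mulfK.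
rewrite /cT !zr_mv Bw.
under eq_bigr do rewrite Bw.
under [in RHS]eq_bigr do rewrite /g shift_idx// mulrDl mulrDr.
rewrite big_split/= /g shiftD//; last exact: dom_gU.
rewrite shift_gU gU_notP// /shift /opL -!scM.
set S1 := \sum_i _; set S2 := \sum_i _; set S3 := \sum_i _.
have -> : S3 = S2 / sc k.
  rewrite /S3 /S2 mulr_suml; apply: eq_bigr => i _; rewrite -[zr _ _ _](mulKf (sc_neq0 k)) sc_zr.
  by field; rewrite !sc_neq0.
by field; rewrite !sc_neq0.
Qed.

Lemma lower_notP z k : complex.Re z <= z0 -> ~~ P k ->
  d k <= nrm ((lam k)%:C - z).
Proof.
move=> hz /lam_hi h; apply: le_trans (Re_le_nrm _); rewrite ReB/= /d.
rewrite gtr0_norm ?subr_gt0// ger0_norm; first by rewrite lerD2l lerN2.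
by rewrite subr_ge0 (le_trans hz)// ltW.
Qed.

Lemma lower_P z k : z0 <= complex.Re z -> P k -> d k <= nrm ((lam k)%:C - z).
Proof.
move=> hz /lam_lo h; apply: le_trans (Re_le_nrm _); rewrite ReB/= /d.
rewrite distrC gtr0_norm ?subr_gt0// distrC ger0_norm ?lerD2r//.
by rewrite subr_ge0 (le_trans _ hz)// ltW.
Qed.

Lemma ratio_ge z k (a : C) : d k <= nrm ((lam k)%:C - z) ->
  nrm a <= nrm (((lam k)%:C - z) / (d k)%:C * a).
Proof.
move=> h; rewrite !nrmM ler_peMl ?nrm_ge0// nrmV nrm_real gtr0_norm//.
by rewrite ler_pdivlMr// mul1r.
Qed.

Lemma complement_bound z om eta t r : complex.Re z <= z0 -> l2 om t ->
  supQ om -> l2 eta r ->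
  (forall k, ~~ P k -> ((lam k)%:C - z) / (d k)%:C * om k + cT om k = eta k) ->
  l2 om (r / (1 - 3 / 16)).
Proof.
move=> hz ht h0 he e.
have q0 : 0 <= 3 / 16 :> R by lra.
have q1 : 3 / 16 < 1 :> R by lra.
apply: l2_self_improve q0 q1 ht _ => t' ht'.
apply: l2_dom (l2B he (l2_T ht')) => k.
have [/h0 ->|Pk] := boolP (P k); first by rewrite nrm0 nrm_ge0.
by rewrite -e// addrK; apply/ratio_ge/lower_notP.
Qed.

Lemma TB om om' r r' : l2 om r -> l2 om' r' ->
  cT (fun k => om k - om' k) = fun k => cT om k - cT om' k.
Proof.
move=> h h'; apply/funext => k; rewrite /cT (mvB hb h h').
by rewrite (mvB (hs_zr hx) (l2_mv hb h) (l2_mv hb h')) subBB.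
Qed.

(** The rescaled equation is a fixed point problem for a contraction with
    constant 3/16; the radius [r + r] leaves room for [r + 3/16 (r + r)]. *)
Lemma complement_solve z eta r : complex.Re z <= z0 -> l2 eta r ->
  exists om, [/\ exists t, l2 om t, supQ om &
    forall k, ~~ P k -> ((lam k)%:C - z) / (d k)%:C * om k + cT om k = eta k].
Proof.
move=> hz he; have r0 := l2_ge0 he.
pose F (om : int -> C) k : C :=
  if P k then 0 else (eta k - cT om k) / (((lam k)%:C - z) / (d k)%:C).
have F0 om k : P k -> F om k = 0 by rewrite /F => ->.
have FE om k : ~~ P k ->
    F om k = (eta k - cT om k) / (((lam k)%:C - z) / (d k)%:C).
  by rewrite /F => /negbTE ->.
have nz k : ~~ P k -> ((lam k)%:C - z) / (d k)%:C != 0.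
  move=> Pk; rewrite mulf_neq0 ?invr_neq0 ?dC_neq0//.
  apply/eqP => h0; have := lower_notP hz Pk; rewrite h0 nrm0 leNgt.
  by rewrite d_gt0.
have small k (a : C) : ~~ P k ->
    nrm (a / (((lam k)%:C - z) / (d k)%:C)) <= nrm a.
  move=> Pk; have := ratio_ge (a / (((lam k)%:C - z) / (d k)%:C)) (lower_notP hz Pk).
  by rewrite [X in _ <= nrm X]mulrC divfK ?nz.
have R0 : 0 <= r + r by rewrite addr_ge0.
have q0 : 0 <= 3 / 16 :> R by lra.
have q1 : 3 / 16 < 1 :> R by lra.
have [||om hom Fom] := @l2_fixpoint R _ F _ _ R0 q0 q1.
- move=> om hom; apply: (@l2_mono _ _ _ (r + 3 / 16 * (r + r))); last lra.
  apply: l2_dom (l2B he (l2_T hom)) => k; have [Pk|Pk] := boolP (P k).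
    by rewrite F0// nrm0 nrm_ge0.
  by rewrite FE//; apply: small.
- move=> om om' t h h' hB; apply: l2_dom (l2_T hB) => k.
  have e := congr1 (fun F => F k) (TB h h'); rewrite [X in _ <= nrm X]e.
  have [Pk|Pk] := boolP (P k).
    by rewrite !F0// subrr nrm0 nrm_ge0.
  rewrite !FE// -mulrBl; apply: le_trans (small _ _ Pk) _.
  move: (cT om k) (cT om' k) (eta k) => p p' e0.
  have -> : e0 - p - (e0 - p') = p' - p by ring.
  by rewrite nrmB.
exists om; split; first by exists (r + r).
  by move=> k Pk; rewrite -Fom F0.
move=> k Pk; rewrite -{1}Fom FE// [X in X + _]mulrC divfK ?nz//.
by rewrite subrK.
Qed.

Definition lowrow (f : int -> C) : 'rV[C]_n := \row_i f (idx i).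
Definition upper (f : int -> C) k : C := f k - gU (lowrow f) k.

Lemma lowrow_upper f : f = fun k => gU (lowrow f) k + upper f k.
Proof. by apply/funext => k; rewrite /upper addrC subrK. Qed.

Lemma upper_supQ f : supQ (upper f).
Proof. by move=> k /idxP[i ->]; rewrite /upper gU_idx mxE subrr. Qed.

Lemma dom_upper f : dom f -> dom (upper f).
Proof. by move=> df; apply: domB => //; apply: dom_gU. Qed.

Lemma l2_sub_zr (ga : int -> C) r : l2 ga r ->
  l2 (fun k => ga k - mv (zr x) ga k) (r + 2^-1 * r).
Proof. by move=> h; apply: l2B => //; apply: l2_mv h; apply: hs_zr. Qed.

Lemma sc_supQ w : supQ w -> supQ (fun k => sc k * w k).
Proof. by move=> h k Pk; rewrite h ?mulr0. Qed.

Lemma upper_bound z f r : complex.Re z <= z0 -> dom f ->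
  l2 (fun k => shift z f k / sc k) r ->
  l2 (fun k => sc k * upper f k) ((r + 2^-1 * r) / (1 - 3 / 16)).
Proof.
move=> hz df hg; have [t ht] := dom_upper df.
apply: complement_bound hz ht (sc_supQ (@upper_supQ f)) (l2_sub_zr hg) _ => k Pk.
have h := shift_notP z (lowrow f) (dom_upper df) (@upper_supQ f) Pk.
by rewrite -(lowrow_upper f) in h.
Qed.

(** The complementary component solves the homogeneous equation, hence
    vanishes. *)
Lemma gU_preimage z f a : complex.Re z <= z0 -> dom f -> shift z f = gU a ->
  f = gU (lowrow f).
Proof.
move=> hz df e; have [t ht] := dom_upper df.
have /l2_0_eq h : l2 (fun k => sc k * upper f k) 0.
  have := complement_bound hz ht (sc_supQ (@upper_supQ f)) (l2_zero _ (lexx 0)).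
  rewrite mul0r; apply=> k Pk.
  have h := shift_notP z (lowrow f) (dom_upper df) (@upper_supQ f) Pk.
  rewrite -(lowrow_upper f) in h; rewrite h e zr_mv gU_notP// mulr_suml.
  rewrite -sumrB big1// => i _; rewrite gU_idx.
  by rewrite -[zr _ _ _](mulKf (sc_neq0 k)) sc_zr; field; rewrite !sc_neq0.
rewrite [LHS]lowrow_upper; apply/funext => k.
have /= /eqP := congr1 (fun F => F k) h; rewrite mulf_eq0 (negbTE (sc_neq0 k))/=.
by move=> /eqP ->; rewrite addr0.
Qed.

Lemma shift_block_inj z (a : 'rV[C]_n) : z0 <= complex.Re z -> a *m (gG - z%:M) = 0 -> a = 0.
Proof.
move=> hz e; pose al k : C := if P k then sc k * gU a k else 0.
have hal : exists t, l2 al t.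
  have [t ht] := dom_gU a; exists t; apply: l2_dom ht => k.
  by rewrite /al; case: ifP => // _; rewrite nrm0 nrm_ge0.
have [t ht] := hal.
have q0 : 0 <= 3 / 16 :> R by lra.
have q1 : 3 / 16 < 1 :> R by lra.
have /l2_0_eq al0 : l2 al 0.
  have := @l2_self_improve _ _ _ 0 _ _ q0 q1 ht; rewrite mul0r; apply.
  move=> t' ht'; rewrite add0r; apply: l2_dom (l2_mv hs_c ht') => k.
  have [Pk|Pk] := boolP (P k); last by rewrite /al (negbTE Pk) nrm0 nrm_ge0.
  apply: le_trans (ratio_ge _ (lower_P hz Pk)) _.
  suff -> : ((lam k)%:C - z) / (d k)%:C * al k = - mv c al k by rewrite nrmN.
  have [j ej] := idxP Pk.
  have := congr1 (fun M : 'rV_n => M 0 j) e.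
  rewrite mulmxBr mul_mx_scalar !mxE.
  under eq_bigr do rewrite mxE mulrDr.
  rewrite big_split/= (bigD1 j)//= big1 ?addr0 => [|i ij]; last first.
    by rewrite (negbTE ij) mul0r mulr0.
  rewrite eqxx mul1r => /eqP; rewrite subr_eq0 => /eqP ez.
  rewrite /mv int_sum_P => [|p Pp]; last by rewrite /al (negbTE Pp) mulr0.
  have -> : \sum_i c k (idx i) * al (idx i) =
      (sc k)^-1 * \sum_i a 0 i * (sc (idx i) * sc (idx j) * c (idx j) (idx i)).
    rewrite mulr_sumr; apply: eq_bigr => i _.
    by rewrite /al P_idx gU_idx -ej; field; rewrite sc_neq0.
  rewrite {1}/al Pk ej gU_idx -scM.
  move: ez; set S := \sum_i _ => ez.
  have -> : S = z * a 0 j - a 0 j * (lam (idx j))%:C by rewrite -ez; ring.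
  by field; rewrite sc_neq0.
apply/rowP => j; rewrite mxE.
have := congr1 (fun F => F (idx j)) al0; rewrite /al P_idx gU_idx => /eqP.
by rewrite mulf_eq0 (negbTE (sc_neq0 _)) => /eqP.
Qed.

Lemma shift_solve z g r : complex.Re z <= z0 -> gG - z%:M \in unitmx ->
  l2 (fun k => g k / sc k) r -> exists2 f, dom f & shift z f = g.
Proof.
move=> hz Gu hg.
have [om [[t ht] om0 ome]] := complement_solve hz (l2_sub_zr hg).
pose w k := om k / sc k.
have omE : (fun k => sc k * w k) = om.
  by apply/funext => k; rewrite /w mulrC divfK.
have dw : dom w by exists t; rewrite omE.
have w0 : supQ w by move=> k Pk; rewrite /w om0// mul0r.
pose a := (lowrow g - lowrow (mv B w)) *m invmx (gG - z%:M).
have aE : a *m (gG - z%:M) = lowrow g - lowrow (mv B w) by rewrite mulmxKV.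
exists (fun k => gU a k + w k); first by apply: domD => //; exact: dom_gU.
have gP j : shift z (fun k => gU a k + w k) (idx j) = g (idx j).
  by rewrite shift_idx// aE !mxE subrK.
apply/funext => k; have [/idxP[j ->]//|Pk] := boolP (P k).
have omk : sc k * w k = om k by rewrite -omE.
have := shift_notP z a dw w0 Pk; rewrite /= omE omk ome// !zr_mv.
under [in RHS]eq_bigr do rewrite gP.
by move=> /addIr /(mulIf (invr_neq0 (sc_neq0 k))).
Qed.

Lemma l2_sum (J : Type) (s : seq J) (f : J -> int -> C) (r : J -> R) :
  (forall j, l2 (f j) (r j)) ->
  l2 (fun k => \sum_(j <- s) f j k) (\sum_(j <- s) r j).
Proof.
move=> h; elim: s => [|y s IH].
  by rewrite big_nil; apply: l2_dom (l2_zero _ (lexx 0)) => k; rewrite big_nil.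
by under eq_fun do rewrite big_cons; rewrite big_cons; apply: l2D.
Qed.

Lemma shift_bound z : complex.Re z <= z0 -> gG - z%:M \in unitmx ->
  exists2 K : R, 0 <= K & forall f r, dom f ->
    l2 (fun k => shift z f k / sc k) r -> l2 (fun k => sc k * f k) (K * r).
Proof.
move=> hz Gu; pose Gi := invmx (gG - z%:M).
pose q : R := (1 + 2^-1) / (1 - 3 / 16).
pose A i : R := \sum_j (nrm (sc (idx j)) + nrm (sc (idx j)) * (8^-1 * q)) * nrm (Gi j i).
pose E i : R := nrm (sc (idx i)) + nrm (sc (idx i)) * 2^-1.
have q0 : 0 <= q by rewrite /q divr_ge0//; lra.
have A0 i : 0 <= A i.
  have e0 : 0 <= 8^-1 * q by rewrite mulr_ge0// invr_ge0.
  apply: sumr_ge0 => j _; apply: mulr_ge0; last exact: nrm_ge0.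
  by apply: addr_ge0; [exact: nrm_ge0|apply: mulr_ge0 => //; exact: nrm_ge0].
have E0 i : 0 <= E i by rewrite addr_ge0 ?mulr_ge0 ?nrm_ge0//; lra.
exists (\sum_i A i * E i + q).
  by rewrite addr_ge0// sumr_ge0// => i _; rewrite mulr_ge0.
move=> f r df hg; have r0 := l2_ge0 hg.
have hw := upper_bound hz df hg.
have -> : (\sum_i A i * E i + q) * r = \sum_i (A i * r) * E i + q * r.
  by rewrite mulrDl mulr_suml; congr (_ + _); apply: eq_bigr => i _; ring.
have eq : q * r = (r + 2^-1 * r) / (1 - 3 / 16) by rewrite /q; ring.
rewrite {1}(lowrow_upper f).
suff hU : l2 (fun k => sc k * gU (lowrow f) k) (\sum_i (A i * r) * E i).
  by rewrite eq; apply: l2_dom (l2D hU hw) => k; rewrite mulrDr.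
have aE : lowrow f = (lowrow (shift z f) - lowrow (mv B (upper f))) *m Gi.
  rewrite /Gi; apply: (canRL (mulmxK Gu)); apply/rowP => j; rewrite [RHS]mxE.
  have h := shift_idx z (lowrow f) j (dom_upper df) (@upper_supQ f).
  rewrite -(lowrow_upper f) in h.
  have -> : lowrow (shift z f) 0 j = shift z f (idx j) by rewrite mxE.
  have -> : (- lowrow (mv B (upper f))) 0 j = - mv B (upper f) (idx j).
    by rewrite !mxE.
  by rewrite h addrK.
have ai i : nrm (lowrow f 0 i) <= A i * r.
  rewrite aE mxE; apply: le_trans (nrm_sum _ _ _) _.
  rewrite mulr_suml; apply: ler_sum => j _; rewrite nrmM mulrAC.
  apply: ler_wpM2r; first exact: nrm_ge0.
  rewrite !mxE mulrDl; apply: le_trans (nrmD _ _) _; rewrite nrmN.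
  apply: lerD.
    have := l2_pt (idx j) hg; rewrite nrmM nrmV ler_pdivrMr; first by rewrite mulrC.
    by rewrite lt_neqAle nrm_ge0 andbT eq_sym; apply/eqP => /nrm0_eq0 /eqP; rewrite (negbTE (sc_neq0 _)).
  rewrite mvB_scaled; last exact: dom_upper.
  rewrite nrmM -mulrA ler_wpM2l ?nrm_ge0// -mulrA eq.
  exact: l2_pt (l2_mv hb hw).
have h i : l2 (fun k => lowrow f 0 i * (sc k * gu i k)) (A i * r * E i).
  by apply: l2_mono (l2Z (lowrow f 0 i) (l2_gu i)) (ler_wpM2r (E0 i) (ai i)).
apply: l2_dom (l2_sum (index_enum _) h) => k.
rewrite /gU mulr_sumr; rewrite le_eqVlt; apply/orP; left; apply/eqP; congr nrm; apply: eq_bigr => i _.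
by rewrite mulrCA.
Qed.

End AngularOperator.

(** Modulo the invariant subspace the operator is the diagonal above the gap with
    a perturbation of relative size 3/16. For [Re z <= z0] the entries of
    [lam - z] above the gap have modulus at least [d], so only the matrix [G] can
    obstruct the inversion of [L - z]. For [Re z >= z0] the same comparison below
    the gap makes [G - z] injective. *)
Theorem gap_decoupling :
  exists (G : 'M[C]_N.*2.+1) (u : 'I_N.*2.+1 -> int -> C),
    let U : 'rV[C]_N.*2.+1 -> int -> C := lincomb u in
    [/\ forall i, dom (u i),
        forall a, U a = (fun=> 0) -> a = 0,
        forall z a, shift z (U a) = U (a *m (G - z%:M)) &
    [/\ forall z f a, complex.Re z <= z0 -> dom f -> shift z f = U a ->
          exists c, f = U c,
        forall z (a : 'rV_N.*2.+1), z0 <= complex.Re z -> a *m (G - z%:M) = 0 -> a = 0,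
        forall z g r, complex.Re z <= z0 -> G - z%:M \in unitmx ->
          l2 (fun k => g k / sc k) r -> exists2 f, dom f & shift z f = g &
        forall z, complex.Re z <= z0 -> G - z%:M \in unitmx ->
          exists2 K : R, 0 <= K & forall f r, dom f ->
            l2 (fun k => shift z f k / sc k) r -> l2 (fun k => sc k * f k) (K * r)]].
Proof.
have [x hx xE] := riccati.
exists (gG x), (gu x); split.
- exact: dom_gu.
- move=> a h; apply/rowP => j; rewrite mxE -(gU_idx xE a j).
  exact: (congr1 (fun F => F (idx j)) h).
- by move=> z a; apply: shift_gU.
- split.
  + by move=> z f a hz df /(gU_preimage hx xE hz df) e; exists (lowrow f).
  + by move=> z a; apply: shift_block_inj.
  + by move=> z g r; apply: shift_solve.
  + by move=> z; apply: shift_bound.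
Qed.

End Gap.

(** The rescaled eigenvector [phi = s f] satisfies [|phi k| = |(b phi) k|], so its
    norm is at most [q] times itself. *)
Lemma no_eigenvector (R : realType) (lam : int -> R) (B : int -> int -> R[i])
    (z : R[i]) (q r : R) (f : int -> R[i]) :
  let d k := nrm ((lam k)%:C - z) in
  let s k := (Num.sqrt (d k))%:C in
  (forall k, 0 < d k) -> q < 1 ->
  hs (fun k j => B k j / (s k * s j)) q -> l2 (fun k => s k * f k) r ->
  shift lam B z f = (fun=> 0) -> f = (fun=> 0).
Proof.
move=> d s d0 q1 hb hf e.
have s0 k : s k != 0 by rewrite /s eq_complex/= eqxx andbT gt_eqF// sqrtr_gt0.
have nsM k : nrm (s k) * nrm (s k) = d k.
  by rewrite -nrmM /s -rmorphM/= -expr2 sqr_sqrtr ?ltW// nrm_real gtr0_norm.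
have /l2_0_eq h : l2 (fun k => s k * f k) 0.
  have := @l2_self_improve _ _ _ 0 q _ (l2_ge0 hb) q1 hf; rewrite mul0r; apply.
  move=> t ht; rewrite add0r; apply: l2_dom (l2_mv hb ht) => k.
  set M := mv _ _ k.
  have BM : mv B f k = s k * M.
    rewrite /M /mv -(int_sumZ _ (l2_asum (hs_row k hb) ht)); congr int_sum.
    by apply/funext => p; field; rewrite !s0.
  have := congr1 (fun F => F k) e; rewrite /shift /opL BM => ek.
  have {}ek : ((lam k)%:C - z) * f k = - (s k * M).
    by apply/eqP; rewrite -addr_eq0 -ek; apply/eqP; ring.
  have sk0 : 0 < nrm (s k).
    by rewrite lt_neqAle nrm_ge0 andbT eq_sym; apply/eqP => /nrm0_eq0 /eqP; rewrite (negbTE (s0 k)).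
  have := congr1 (@nrm R) ek; rewrite nrmN !nrmM -/(d k) -nsM -mulrA.
  by move=> /(mulfI (lt0r_neq0 sk0)) ->.
apply/funext => k; have /= /eqP := congr1 (fun F => F k) h.
by rewrite mulf_eq0 (negbTE (s0 k)) => /eqP.
Qed.

(** * Sobolev norms and the operator in Fourier coordinates *)

Section Fourier.
Variable R : realType.
Local Notation C := R[i].
Local Notation br := (bracket R).

Lemma bracket_ge1 k : 1 <= br k.
Proof. by rewrite /bracket lerDl. Qed.

Lemma bracket_gt0 k : 0 < br k.
Proof. exact: lt_le_trans ltr01 (bracket_ge1 k). Qed.

Lemma esum_le_l2 (w : int -> R) (f : int -> C) (r : R) : 0 <= r ->
  (forall k, 0 <= w k) ->
  (\esum_(k in [set: int]) (w k ^+ 2 * complex.Re `|f k| ^+ 2)%:E <= (r ^+ 2)%:E)%E <->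
  l2 (fun k => (w k)%:C * f k) r.
Proof.
move=> r0 w0.
have e (s : seq int) : \sum_(k <- s) nrm ((w k)%:C * f k) ^+ 2 =
    \sum_(k <- s) w k ^+ 2 * complex.Re `|f k| ^+ 2.
  by apply: eq_bigr => k _; rewrite nrmM nrm_real exprMn ger0_norm.
split=> [h|[_ h]].
  split=> // s us; rewrite -lee_fin e; apply: le_trans h.
  rewrite -sumEFin fsbig_seq//; apply: ereal_sup_ubound.
  by exists [set` s] => //; split => //; exact: finite_seq.
apply: ub_ereal_sup => _ [A [fA _] <-].
by rewrite fsbig_finite//= sumEFin lee_fin -e; apply/h/finmap.fset_uniq.
Qed.

Lemma sobolev_norm_le (s r : R) (f : fourier R) : 0 <= r ->
  (sobolev_norm s f <= r%:E)%E <-> l2 (fun k => (br k `^ s)%:C * f k) r.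
Proof.
move=> r0; rewrite -esum_le_l2// => [|k]; last exact: powR_ge0.
rewrite /sobolev_norm.
under eq_esum => k _ do rewrite [2 * s]mulrC powRrM powR_mulrn ?powR_ge0//.
set E := esum _ _.
have E0 : (0 <= E)%E.
  by apply: esum_ge0 => k _; rewrite lee_fin mulr_ge0 ?sqr_ge0.
case: E E0 => [x| |]//=; rewrite ?lee_fin => x0.
  rewrite powR12_sqrt// -(@ler_pXn2r _ 2)// ?nnegrE ?sqrtr_ge0//.
  by rewrite sqr_sqrtr.
by rewrite invr_eq0 pnatr_eq0/=; split; rewrite leye_eq.
Qed.

Lemma sobolevP (s : R) (f : fourier R) :
  sobolev s f <-> exists r, l2 (fun k => (br k `^ s)%:C * f k) r.
Proof.
rewrite /sobolev/=; split=> [|[r hr]].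
  have : (0 <= sobolev_norm s f)%E by exact: poweR_ge0.
  case E : sobolev_norm => [x| |]//=; rewrite lee_fin => x0 _.
  by exists x; apply/sobolev_norm_le => //; rewrite E.
by apply: (@le_lt_trans _ _ r%:E); rewrite ?ltry//;
  apply/sobolev_norm_le => //; apply: l2_ge0 hr.
Qed.

Definition eig (m : nat) (k : int) : R := (k%:~R * pi) ^+ (2 * m).

Lemma eigE m k : eig m k = (absz k)%:R ^+ (2 * m) * pi ^+ (2 * m).
Proof.
rewrite /eig exprMn; congr (_ * _); rewrite !exprM; congr (_ ^+ _).
by rewrite -[LHS]real_normK ?num_real// -intr_norm -abszE.
Qed.

Lemma LE m (V f : fourier R) : L m V f = opL (eig m) (fun k j => V (k - j)) f.
Proof.
apply/funext => k; rewrite /L /opL /fourier_mul /mv; congr (_ + _).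
have -> p : iter p (@fourier_deriv R) f k = ('i%C * k%:~R * (pi : R)%:C) ^+ p * f k.
  by elim: p => [|p IH]; rewrite ?mul1r// iterS /fourier_deriv IH exprS mulrA.
rewrite mulrA; congr (_ * _).
rewrite -mul2n exprM -exprMn /eig exprM rmorphXn; congr (_ ^+ _).
rewrite rmorphXn rmorphM/= rmorph_int !exprMn sqr_i; ring.
Qed.

Lemma L_shiftE m (V f : fourier R) z :
  L_shift m V z f = shift (eig m) (fun k j => V (k - j)) z f.
Proof. by rewrite /L_shift LE. Qed.

End Fourier.

(** * Smallness of the perturbation relative to the resolvent *)

Section Sums.
Variable R : realType.

Lemma sum_perm2 (F : int -> R) (a b : int) (s s' : seq int) :
  perm_eq s' [:: a, b & s] ->
  \sum_(i <- s') F i = F a + F b + \sum_(i <- s) F i.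
Proof. by move=> pe; rewrite (perm_big _ pe)/= 2!big_cons addrA. Qed.

Lemma sum_inv_sqr (s : seq int) : uniq s ->
  \sum_(i <- s) ((1 + (absz i)%:R) ^+ 2)^-1 <= 3 :> R.
Proof.
move=> us; have [M /(_ M (leqnn M)) sM] := sub_win s.
apply: le_trans (sum_subset _ us sM) _ => [i|].
  by rewrite invr_ge0 sqr_ge0.
(* [2 / (1 + x)^2 <= 2 / x - 2 / (1 + x)] telescopes *)
suff h : \sum_(i <- win M) ((1 + (absz i)%:R) ^+ 2)^-1 <= 3 - 2 / M.+1%:R :> R.
  by apply: le_trans h _; rewrite gerBl divr_ge0.
elim: M {sM} => [|M IH].
  by rewrite big_seq1 /= addr0 expr1n; lra.
have pe : perm_eq (win M.+1) [:: M.+1%:Z, - M.+1%:Z & win M].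
  apply: uniq_perm; first exact: win_uniq.
    by rewrite 2!cons_uniq inE !mem_win win_uniq; lia.
  by move=> i; rewrite mem_win 2!in_cons mem_win; lia.
rewrite (sum_perm2 _ pe).
have -> : (absz (- M.+1%:Z)%R)%:R = M.+1%:R :> R by congr (_%:R); lia.
rewrite -mulr2n /absz.
set f := \sum_(i <- _) _ in IH *.
have e : M.+2%:R = 1 + M.+1%:R :> R by rewrite -natr1 addrC.
have x0 : 0 < M.+1%:R :> R by rewrite ltr0n.
rewrite e; move: M.+1%:R x0 IH => x x0 IH.
have x1 : 0 < 1 + x by rewrite addr_gt0.
have h : ((1 + x) ^+ 2)^-1 *+ 2 <= 2 / x - 2 / (1 + x).
  have -> : 2 / x - 2 / (1 + x) = (x * (1 + x))^-1 *+ 2.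
    by field; rewrite !gt_eqF.
  rewrite lerMn2r/= lef_pV2 ?posrE ?mulr_gt0 ?exprn_gt0// expr2 ler_wpM2r ?ltW//.
  by rewrite ltrDr.
by move: IH h; lra.
Qed.

(** A summable weight concentrated at the two unperturbed indices [n] and
    [- n] *)
Definition pk (n : nat) (k : int) : R := ((1 + `|(absz k)%:R - n%:R|) ^+ 2)^-1.

Lemma pk_ge0 n k : 0 <= pk n k.
Proof. by rewrite invr_ge0 sqr_ge0. Qed.

(** As [|k|] is [k] or [- k], the weight is at most the sum of the shifts by [n]
    and by [- n] of the weight at the origin. *)
Lemma sum_pk n (s : seq int) : uniq s -> \sum_(k <- s) pk n k <= 6.
Proof.
move=> us.
have h (c : int) : \sum_(k <- s) ((1 + (absz (k + c)%R)%:R) ^+ 2)^-1 <= 3 :> R.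
  rewrite -(big_map (fun k => k + c) xpredT (fun k => ((1 + (absz k)%:R) ^+ 2)^-1 : R)).
  by apply: sum_inv_sqr; rewrite map_inj_uniq//; apply: addIr.
have -> : 6 = 3 + 3 :> R by rewrite -natrD.
apply: le_trans (lerD (h n%:Z) (h (- n%:Z))); rewrite -big_split/=.
apply: ler_sum => k _; rewrite /pk.
have ge0 (x : R) : 0 <= (x ^+ 2)^-1 by rewrite invr_ge0 sqr_ge0.
have [k0|k0] := leP 0 k.
  suff -> : `|(absz k)%:R - n%:R| = (absz (k - n%:Z)%R)%:R :> R by rewrite lerDr.
  by case: k k0 => // k _; rewrite [RHS]natr_absz intr_norm rmorphB.
suff -> : `|(absz k)%:R - n%:R| = (absz (k + n%:Z)%R)%:R :> R by rewrite lerDl.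
case: k k0 => // k _; rewrite NegzE [RHS]natr_absz intr_norm rmorphD rmorphN.
by rewrite abszN -normrN opprB addrC.
Qed.

(** Pairs [(k, j)] are counted by their difference [l = k - j] and by [k]. *)
Lemma sum_diff (n : nat) (c : int -> R) (K : R) : (forall l, 0 <= c l) ->
  (forall s, uniq s -> \sum_(l <- s) c l <= K) ->
  forall s : seq (int * int), uniq s ->
  \sum_(x <- s) c (x.1 - x.2) * (pk n x.1 + pk n x.2) <= 12 * K.
Proof.
move=> c0 cK s us.
pose Ls := undup [seq x.1 - x.2 | x <- s]; pose Ks := undup [seq x.1 | x <- s].
pose h (x : int * int) := (x.1 - x.2, x.1).
have hinj : injective h by move=> [a b] [a' b'] [/= e ea]; congr (_, _); lia.
have -> : \sum_(x <- s) c (x.1 - x.2) * (pk n x.1 + pk n x.2) =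
    \sum_(y <- [seq h x | x <- s]) c y.1 * (pk n y.2 + pk n (y.2 - y.1)).
  by rewrite big_map; apply: eq_bigr => x _ /=; rewrite subKr.
apply: le_trans (@sum_subset _ _ _ _ [seq (l, k) | l <- Ls, k <- Ks] _ _ _) _.
- by move=> y; rewrite mulr_ge0// addr_ge0// pk_ge0.
- by rewrite map_inj_uniq.
- move=> _ /mapP[x xs ->]; apply/allpairsP; exists (h x).
  by rewrite !mem_undup; split=> //; apply/mapP; exists x.
rewrite big_allpairs/=.
apply: le_trans (_ : \sum_(l <- Ls) c l * 12 <= _); last first.
  by rewrite -mulr_suml mulrC ler_wpM2l// cK// undup_uniq.
apply: ler_sum => l _; rewrite -mulr_sumr ler_wpM2l// big_split/=.
have -> : 12 = 6 + 6 :> R by rewrite -natrD.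
apply: lerD; first by apply: sum_pk; rewrite undup_uniq.
rewrite -(big_map (fun k => k - l) xpredT (pk n)); apply: sum_pk.
by rewrite map_inj_uniq ?undup_uniq//; apply: addIr.
Qed.

Lemma summable_tail (w : int -> R) (K e : R) : (forall k, 0 <= w k) ->
  (forall s, uniq s -> \sum_(k <- s) w k <= K) -> 0 < e ->
  exists L : nat, forall s, uniq s -> (forall k, k \in s -> (L < absz k)%N) ->
    \sum_(k <- s) w k <= e.
Proof.
move=> w0 wK e0.
pose A := [set \sum_(k <- s) w k | s in [set s : seq int | uniq s]].
have hA : has_sup A.
  split; first by exists 0, [::] => //; rewrite big_nil.
  by exists K => _ [s us <-]; apply: wK.
have [_ [s us <-] hs] := sup_adherent e0 hA.
have [M /(_ M (leqnn M)) sM] := sub_win s; exists M => t ut tM.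
have : \sum_(k <- s ++ t) w k <= sup A.
  apply: sup_upper_bound => //; exists (s ++ t) => //=.
  rewrite cat_uniq us ut andbT/=; apply/hasPn => k /tM kM.
  by apply: contraL kM => /sM; rewrite mem_win -leqNgt.
by rewrite big_cat/=; move: hs; lra.
Qed.

End Sums.

Section Separation.
Variables (R : realType) (m : nat).
Hypothesis m0 : (0 < m)%N.
Local Notation C := R[i].
Local Notation br := (bracket R).

(** Up to a constant factor, [z] is at least as far from each point of the unperturbed
    spectrum as a point on the circle of radius [n^m] about [(n pi)^(2 m)]. *)
Definition sep (n : nat) (z : C) : Prop := forall k : int,
  n%:R ^+ m <= 2 * nrm ((eig R m k)%:C - z) /\
  `|(absz k)%:R ^+ (2 * m) - n%:R ^+ (2 * m)| <= 2 * nrm ((eig R m k)%:C - z).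

Lemma exprD_ge (x y : R) p : 0 <= x -> 0 <= y -> (0 < p)%N ->
  x ^+ p + y ^+ p <= (x + y) ^+ p.
Proof.
move=> x0 y0; case: p => // p _; elim: p => [|p IH]; first by rewrite !expr1.
rewrite [leRHS]exprS; apply: le_trans (ler_wpM2l (addr_ge0 x0 y0) IH).
rewrite mulrDl !mulrDr -!exprS addrACA -addrA lerD2l.
by rewrite addrA lerDr// addr_ge0// mulr_ge0// exprn_ge0.
Qed.

Lemma pow_diff (a b : nat) :
  `|a%:R - b%:R| * (maxn a b)%:R ^+ m <= `|a%:R ^+ (2 * m) - b%:R ^+ (2 * m)| :> R.
Proof.
wlog ab : a b / (b <= a)%N => [h|].
  have [/h//|] := boolP (b <= a)%N; rewrite -ltnNge => /ltnW/h.
  by rewrite (maxnC b a) (distrC b%:R) (distrC (b%:R ^+ _)).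
rewrite (maxn_idPl ab) !exprM ![_ ^+ 2 ^+ _]exprAC subr_sqr normrM.
have le1 : (b%:R : R) <= a%:R by rewrite ler_nat.
have lep : (b%:R : R) ^+ m <= a%:R ^+ m by rewrite lerXn2r ?nnegrE.
rewrite !ger0_norm ?subr_ge0 ?addr_ge0 ?exprn_ge0//.
apply: ler_pM; rewrite ?subr_ge0 ?exprn_ge0// ?lerDl ?exprn_ge0//.
rewrite lerBrDl.
have e0 : 0 <= (a%:R : R) - b%:R by rewrite subr_ge0.
have := exprD_ge (ler0n R b) e0 m0; rewrite [b%:R + _]addrC subrK; apply: le_trans.
rewrite lerD2l -natrB// -natrX ler_nat.
by case: (a - b)%N => // c; rewrite -{1}(expn1 c.+1) leq_pexp2l.
Qed.

Section Bounds.
Variables (n : nat) (z : C).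
Hypothesis n0 : (0 < n)%N.
Hypothesis hsep : sep n z.

Let D k := nrm ((eig R m k)%:C - z).
Let t (k : int) : R := 1 + `|(absz k)%:R - n%:R|.

Lemma sep_n_gt0 : 0 < n%:R :> R. Proof. by rewrite ltr0n. Qed.

Lemma sep_t_ge1 k : 1 <= t k. Proof. by rewrite lerDl. Qed.

Lemma sep_max k : (maxn (absz k) n)%:R ^+ m * t k <= 4 * D k.
Proof.
have [h1 h2] := hsep k; rewrite /t -/(D k) in h1 h2 *.
have [e|ne] := eqVneq (absz k) n.
  by rewrite e maxnn subrr normr0 addr0 mulr1; move: h1 (nrm_ge0 ((eig R m k)%:C - z)); rewrite -/(D k); lra.
have one : 1 <= `|(absz k)%:R - n%:R| :> R.
  have -> : `|(absz k)%:R - n%:R| = (absz ((absz k)%:Z - n%:Z)%R)%:R :> R.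
    by rewrite [RHS]natr_absz intr_norm rmorphB.
  by rewrite ler1n; lia.
have := pow_diff (absz k) n; have : 0 <= (maxn (absz k) n)%:R ^+ m :> R by rewrite exprn_ge0.
move: one h2; set T := `|_ - n%:R|; set X := _ ^+ m; set Y := `|_|.
by nra.
Qed.

Lemma sep_D_gt0 k : 0 < D k.
Proof.
have [h _] := hsep k; have : 0 < n%:R ^+ m :> R by rewrite exprn_gt0// sep_n_gt0.
by rewrite /D; lra.
Qed.

Lemma sep_n_t k : n%:R ^+ m * t k <= 4 * D k.
Proof.
apply: le_trans (sep_max k); rewrite ler_wpM2r//.
  by apply: le_trans (sep_t_ge1 k).
by rewrite lerXn2r ?nnegrE// ler_nat leq_maxr.
Qed.

Lemma sep_t2 k : 1 <= 8 * D k * pk R n k.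
Proof.
rewrite -/(t k) /pk -/(t k) ler_pdivlMr ?exprn_gt0// ?mul1r; last first.
  exact: lt_le_trans (sep_t_ge1 k).
have h := sep_max k; set M := (maxn _ _)%:R in h.
have M1 : 1 <= M by rewrite ler1n leq_max n0 orbT.
have tM : t k <= 2 * M.
  suff : `|(absz k)%:R - n%:R| <= M by rewrite /t; lra.
  rewrite ler_norml; apply/andP; split.
    rewrite lerNl opprB; apply: le_trans (_ : n%:R <= _).
      by rewrite gerBl.
    by rewrite ler_nat leq_maxr.
  apply: le_trans (_ : (absz k)%:R <= _); first by rewrite gerBl.
  by rewrite ler_nat leq_maxl.
have MM : M <= M ^+ m by rewrite ler_eXnr.
have t1 := sep_t_ge1 k.
have h2 : t k * t k <= 2 * (M ^+ m * t k).
  by rewrite mulrA ler_wpM2r//; [exact: le_trans t1|lra].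
by rewrite expr2; lra.
Qed.

(** Far from [n] the unperturbed eigenvalue dominates the weight of [H^m]. *)
Lemma sep_far k : (2 * n <= absz k)%N -> br k ^+ (2 * m) <= 4 * 4 ^+ m * D k.
Proof.
move=> h; have [_ h2] := hsep k; rewrite -/(D k) in h2.
set a := absz k in h h2.
have a1 : 1 <= a%:R :> R by rewrite ler1n; lia.
have na : 2 * n%:R <= a%:R :> R by rewrite -natrM ler_nat.
have h3 : n%:R ^+ (2 * m) <= 2^-1 * a%:R ^+ (2 * m) :> R.
  apply: le_trans (_ : (2^-1 * a%:R) ^+ (2 * m) <= _).
    by rewrite lerXn2r ?nnegrE ?mulr_ge0//; lra.
  rewrite exprMn ler_wpM2r ?exprn_ge0//.
  rewrite -{2}(expr1 2^-1) ler_wiXn2l//; last by lia.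
  by lra.
have h4 : br k <= 2 * a%:R by rewrite /bracket -/a; lra.
have h5 : br k ^+ (2 * m) <= (2 * a%:R) ^+ (2 * m).
  by rewrite lerXn2r ?nnegrE ?mulr_ge0// ltW// bracket_gt0.
have e2 : 2 ^+ (2 * m) = 4 ^+ m :> R by rewrite exprM -natrX.
have u0 : 0 <= 4 ^+ m :> R by rewrite exprn_ge0.
have h6 : a%:R ^+ (2 * m) <= 4 * D k.
  move: h2 h3; set A := a%:R ^+ _; set B := n%:R ^+ _ => h2 h3.
  by have := ler_norm (A - B); move: h2 h3; set T := `|_|; move: (D k) => d; lra.
apply: le_trans h5 _; rewrite exprMn e2; apply: le_trans (ler_wpM2l u0 h6) _.
by rewrite mulrCA mulrA.
Qed.

(** Near [n] each of the two factors contributes [n^m], the radius of the disc,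
    and a decay in the distance to [n]; the product of the decays is split by
    [2 x y <= x^2 + y^2]. *)
Lemma sep_near k j : n%:R ^+ (2 * m) <= 8 * (D k * D j) * (pk R n k + pk R n j).
Proof.
have hk := sep_n_t k; have hj := sep_n_t j.
have tk := lt_le_trans ltr01 (sep_t_ge1 k).
have tj := lt_le_trans ltr01 (sep_t_ge1 j).
have nm : 0 <= n%:R ^+ m :> R by rewrite exprn_ge0.
rewrite mulnC exprM expr2.
have h1 : n%:R ^+ m * n%:R ^+ m <= 16 * (D k * D j) * ((t k)^-1 * (t j)^-1).
  have h2 := ler_pM (mulr_ge0 nm (ltW tk)) (mulr_ge0 nm (ltW tj)) hk hj.
  rewrite -invfM ler_pdivlMr ?mulr_gt0//.
  by move: h2; set x := n%:R ^+ m; lra.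
apply: le_trans h1 _; have DD : 0 <= D k * D j by rewrite mulr_ge0 ?nrm_ge0.
rewrite /pk -/(t k) -/(t j) -!exprVn.
move: DD; set d := D k * D j; set x := (t k)^-1; set y := (t j)^-1 => DD.
have -> : 8 * d * (x ^+ 2 + y ^+ 2) = 16 * d * (x * y) + 8 * d * (x - y) ^+ 2 by ring.
by rewrite lerDl mulr_ge0 ?sqr_ge0// mulr_ge0.
Qed.

Lemma sep_one k j :
  br k ^+ (2 * m) <= 32 * 4 ^+ m * (D k * D j) * (pk R n k + pk R n j).
Proof.
have DD : 0 <= D k * D j by rewrite mulr_ge0 ?nrm_ge0.
have f4 : 0 <= 4 ^+ m :> R by rewrite exprn_ge0.
have [h|h] := leqP (2 * n) (absz k).
  have h1 := sep_far h; have h2 := sep_t2 j.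
  have Dk : 0 <= D k by rewrite nrm_ge0.
  apply: le_trans h1 _; apply: le_trans (ler_peMr _ h2) _.
    by rewrite !mulr_ge0.
  have -> : 4 * 4 ^+ m * D k * (8 * D j * pk R n j) =
    32 * 4 ^+ m * (D k * D j) * pk R n j by ring.
  apply: ler_wpM2l; last by rewrite lerDr pk_ge0.
  by apply: mulr_ge0 => //; apply: mulr_ge0.
have h1 := sep_near k j.
have h2 : br k ^+ (2 * m) <= 4 ^+ m * n%:R ^+ (2 * m).
  have -> : 4 ^+ m * n%:R ^+ (2 * m) = (2 * n%:R) ^+ (2 * m) :> R.
    have e4 : 2 ^+ (2 * m) = 4 ^+ m :> R by rewrite exprM -natrX.
    by rewrite exprMn e4.
  rewrite lerXn2r ?nnegrE ?mulr_ge0 ?(ltW (bracket_gt0 R k))//.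
  by rewrite /bracket addrC natr1 -natrM ler_nat.
apply: le_trans h2 _; apply: le_trans (ler_wpM2l f4 h1) _.
have pp : 0 <= pk R n k + pk R n j by rewrite addr_ge0 ?pk_ge0.
have q0 : 0 <= 4 ^+ m * (D k * D j) * (pk R n k + pk R n j) by apply: mulr_ge0 => //; apply: mulr_ge0.
by move: q0; set u := 4 ^+ m; set d := D k * D j; set p := pk R n k + _; lra.
Qed.

Lemma bracket_sub k j :
  br (k - j) ^+ (2 * m) <= 4 ^+ m * (br k ^+ (2 * m) + br j ^+ (2 * m)).
Proof.
have h1 : br (k - j) <= br k + br j.
  rewrite /bracket.
  have : (absz (k - j)%R)%:R <= (absz k)%:R + (absz j)%:R :> R.
    by rewrite -natrD ler_nat; lia.
  by lra.
have b1 := bracket_gt0 R k; have b2 := bracket_gt0 R j.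
have b3 := bracket_gt0 R (k - j).
have f4 : 2 ^+ (2 * m) = 4 ^+ m :> R by rewrite exprM -natrX.
wlog kj : k j h1 b1 b2 b3 / br k <= br j => [h|].
  have [kj|/ltW kj] := leP (br k) (br j); first exact: h.
  have e : br (j - k) = br (k - j) by rewrite /bracket; congr (1 + _%:R); lia.
  by rewrite -e [br k ^+ _ + _]addrC; apply: h => //; rewrite e// [br j + _]addrC.
apply: le_trans (_ : (2 * br j) ^+ (2 * m) <= _).
  have h2 : br (k - j) <= 2 * br j by lra.
  by rewrite lerXn2r// nnegrE ?mulr_ge0// ltW.
by rewrite exprMn f4 ler_wpM2l ?exprn_ge0// lerDr exprn_ge0// ltW.
Qed.

Definition Ksep : R := 64 * 16 ^+ m.

Lemma sep_bracket k j :
  br (k - j) ^+ (2 * m) <= Ksep * (D k * D j) * (pk R n k + pk R n j).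
Proof.
apply: le_trans (bracket_sub k j) _.
have h1 := sep_one k j; have h2 := sep_one j k.
rewrite [D j * _]mulrC [pk R n j + _]addrC in h2.
have f4 : 0 <= 4 ^+ m :> R by rewrite exprn_ge0.
apply: le_trans (ler_wpM2l f4 (lerD h1 h2)) _.
rewrite /Ksep (_ : 16 = 4 * 4 :> R); last by rewrite -natrM.
rewrite exprMn; set u := 4 ^+ m; set d := D k * D j; set p := pk R n k + _.
by rewrite [leLHS](_ : _ = 64 * (u * u) * d * p)//; ring.
Qed.

(** Each entry of the scaled perturbation is dominated by its Fourier
    coefficient times a factor [c] that is bounded, and that tends to 0 with
    [1 / n] for each fixed [l]. *)
Lemma sep_entry (v : R) (k j : int) (c : R) :
  let l := k - j in
  Ksep <= c \/ 8 * br l ^+ (2 * m) <= c * n%:R ^+ (2 * m) ->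
  0 <= v -> 0 <= c ->
  v * br l ^+ (2 * m) / (D k * D j) <= v * c * (pk R n k + pk R n j).
Proof.
move=> l hc v0 c0; have DD : 0 < D k * D j by rewrite mulr_gt0 ?sep_D_gt0.
have pp : 0 <= pk R n k + pk R n j by rewrite addr_ge0 ?pk_ge0.
rewrite ler_pdivrMr// -!mulrA ler_wpM2l//.
case: hc => hc.
  apply: le_trans (sep_bracket k j) _.
  rewrite -mulrA [_ * (pk R n k + _)]mulrC.
  by apply: ler_wpM2r hc; apply: mulr_ge0 => //; apply: ltW.
have n2 : 0 < n%:R ^+ (2 * m) :> R by rewrite exprn_gt0 ?sep_n_gt0.
rewrite -(ler_pM2r n2).
have b0 : 0 <= br l ^+ (2 * m) by rewrite exprn_ge0// ltW// bracket_gt0.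
have := ler_wpM2l b0 (sep_near k j).
have := ler_wpM2r (mulr_ge0 pp (ltW DD)) hc.
set B := br l ^+ _; set d := D k * D j; set p := _ + _; set N := n%:R ^+ _.
move=> h1 h2; apply: le_trans h2 _.
have -> : B * (8 * d * p) = 8 * B * (p * d) by ring.
by apply: le_trans h1 _; rewrite le_eqVlt; apply/orP; left; apply/eqP; ring.
Qed.

End Bounds.

(** Squared size of the [l]-th Fourier coefficient in [H^(-m)] *)
Definition coef (W : fourier R) (l : int) : R :=
  nrm ((br l `^ (- m%:R))%:C * W l) ^+ 2.

Lemma nrm_coef W l : nrm (W l) ^+ 2 = coef W l * br l ^+ (2 * m).
Proof.
have b0 := bracket_gt0 R l.
rewrite /coef powR_invn ?ltW// nrmM nrm_real ger0_norm ?invr_ge0 ?exprn_ge0 ?ltW//.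
rewrite exprMn mulrAC -exprVn exprVn [(2 * m)%N]mulnC exprM -exprMn mulVf ?expr1n ?mul1r//.
by rewrite expf_neq0// gt_eqF.
Qed.

Lemma hs_sep (n : nat) (z : C) (W : fourier R) (c : int -> R) (K q : R) :
  (0 < n)%N -> sep n z -> (forall l, 0 <= c l) ->
  (forall l, Ksep <= c l \/ 8 * br l ^+ (2 * m) <= c l * n%:R ^+ (2 * m)) ->
  (forall s, uniq s -> \sum_(l <- s) coef W l * c l <= K) ->
  0 <= q -> 12 * K <= q ^+ 2 ->
  let s k := (Num.sqrt (nrm ((eig R m k)%:C - z)))%:C in
  hs (fun k j => W (k - j) / (s k * s j)) q.
Proof.
move=> n0 hz c0 hc hK q0 hq s; split=> // t ut; apply: le_trans hq.
have v0 l : 0 <= coef W l * c l by rewrite mulr_ge0// sqr_ge0.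
apply: le_trans (sum_diff n v0 hK ut).
apply: ler_sum => -[k j] _ /=.
rewrite nrmM nrmV nrmM !nrm_real !ger0_norm ?sqrtr_ge0//.
rewrite exprMn exprVn exprMn !sqr_sqrtr ?nrm_ge0// nrm_coef.
by apply: sep_entry; rewrite ?sqr_ge0.
Qed.

(** The coefficients of [V] with [|l| <= L] are harmless because [n] is large,
    those with [|l| > L] because [V] is in [H^(-m)], and those of [W - V]
    because [W] is close to [V]. *)
Theorem hs_small (V : fourier R) : sobolev (- m%:R) V ->
  exists (eps : R) (n1 : nat), [/\ 0 < eps, (0 < n1)%N &
    forall W : fourier R,
      (sobolev_norm (- m%:R) (fun k => W k - V k)%R <= eps%:E)%E ->
    forall n z, (n1 <= n)%N -> sep n z ->
    let s k := (Num.sqrt (nrm ((eig R m k)%:C - z)))%:C in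
    hs (fun k j => W (k - j) / (s k * s j)) 8^-1].
Proof.
move=> /sobolevP[r [r0 hr]].
have [eta [eta0 eta1 etaE]] : exists eta : R,
    [/\ 0 < eta, eta <= 1 & 12 * (6 * eta) <= 8^-1 ^+ 2].
  by exists (64^-1 * 72^-1); rewrite expr2; split; lra.
have K1 : 1 <= Ksep.
  have h : 1 <= 16 ^+ m :> R by rewrite exprn_ege1// ler1n.
  by rewrite /Ksep; lra.
have K0 : 0 < Ksep by lra.
pose delta : R := eta / (r ^+ 2 + 1).
have r1 : 0 < r ^+ 2 + 1 by rewrite ltr_wpDl ?sqr_ge0.
have delta0 : 0 < delta by rewrite divr_gt0.
have delta1 : delta <= 1.
  rewrite ler_pdivrMr// mul1r.
  by apply: le_trans eta1 _; rewrite lerDr sqr_ge0.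
have [L hL] := @summable_tail R (coef V) (r ^+ 2) (eta / Ksep)
  (fun l => sqr_ge0 _) hr (divr_gt0 eta0 K0).
pose X : R := 8 * L.+1%:R ^+ (2 * m) / delta.
have X0 : 0 <= X.
  by apply: divr_ge0; [apply: mulr_ge0 => //; apply: exprn_ge0|apply: ltW].
exists (eta / Ksep), (Num.bound X).+1; split=> //; first exact: divr_gt0.
move=> W /sobolev_norm_le hW n z nn1 hz.
have e0 : 0 <= eta / Ksep by rewrite ltW// divr_gt0.
have [_ {}hW] := hW e0.
have n0 : (0 < n)%N by apply: leq_trans nn1.
pose c (l : int) : R := if (absz l <= L)%N then delta else Ksep.
have c0 l : 0 <= c l by rewrite /c; case: ifP => _; apply: ltW.
have cK l : c l <= Ksep by rewrite /c; case: ifP => // _; apply: le_trans K1.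
apply: (@hs_sep n z W c (6 * eta)) => //; last first.
- move=> s us.
  have h2 l : coef W l * c l <=
      2 * (coef V l * c l) + 2 * Ksep * nrm ((br l `^ (- m%:R))%:C * (W l - V l)) ^+ 2.
    set v := coef V l; set d := nrm _ ^+ 2.
    have d0 : 0 <= d by rewrite sqr_ge0.
    have h : coef W l <= 2 * v + 2 * d.
      rewrite /v /d /coef.
      have -> : (br l `^ (- m%:R))%:C * W l = (br l `^ (- m%:R))%:C * V l +
        (br l `^ (- m%:R))%:C * (W l - V l) by ring.
      set x := _ * V l; set y := _ * (_ - _).
      have := nrmD x y; have := nrm_ge0 (x + y).
      move: (nrm x) (nrm y) (nrm (x + y)) => a b e e0' eab.
      have : e ^+ 2 <= (a + b) ^+ 2 by rewrite lerXn2r// nnegrE (le_trans e0').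
      by have := sqr_ge0 (a - b); nra.
    apply: le_trans (ler_wpM2r (c0 l) h) _.
    by have := ler_wpM2l d0 (cK l); lra.
  apply: le_trans (ler_sum _ (fun l _ => h2 l)) _.
  rewrite big_split/= -!mulr_sumr.
  have hd : 2 * Ksep * (\sum_(l <- s) nrm ((br l `^ (- m%:R))%:C * (W l - V l)) ^+ 2) <= 2 * eta.
    apply: le_trans (ler_wpM2l (mulr_ge0 _ (ltW K0)) (hW s us)) _ => //.
    have e1 : Ksep * (eta / Ksep) ^+ 2 = eta * (eta / Ksep).
      by field; rewrite gt_eqF.
    rewrite -mulrA e1 ler_pM2l// ler_piMr ?(ltW eta0)//.
    by rewrite ler_pdivrMr// mul1r; apply: le_trans eta1 K1.
  have hv : \sum_(l <- s) coef V l * c l <= 2 * eta.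
    rewrite (bigID (fun l => (absz l <= L)%N))/= mulr_natl mulr2n; apply: lerD.
      apply: le_trans (_ : \sum_(l <- s) coef V l * delta <= _).
        rewrite [leRHS](bigID (fun l => (absz l <= L)%N))/= ler_wpDr//.
          by apply: sumr_ge0 => l _; rewrite mulr_ge0 ?sqr_ge0 ?ltW.
        by apply: ler_sum => l h; rewrite /c h.
      rewrite -mulr_suml; apply: le_trans (ler_wpM2r (ltW delta0) (hr s us)) _.
      rewrite /delta mulrCA ger_pMr// ler_pdivrMr// mul1r.
      by rewrite lerDl.
    rewrite -big_filter.
    apply: le_trans (_ : (eta / Ksep) * Ksep <= _); last by rewrite divfK// gt_eqF.
    apply: le_trans (_ : (\sum_(l <- [seq l <- s | ~~ (absz l <= L)%N]) coef V l) * Ksep <= _).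
      by rewrite mulr_suml; apply: ler_sum => l _; rewrite ler_wpM2l ?sqr_ge0.
    apply: (ler_wpM2r (ltW K0)); apply: hL; first by rewrite filter_uniq.
    by move=> l; rewrite mem_filter -ltnNge => /andP[].
  by lra.
- move=> l; rewrite /c; case: leqP => h; [right|left=> //].
  rewrite [delta * _]mulrC -(ler_pdivrMr _ _ delta0).
  have nX : X <= n%:R.
    apply: le_trans (ltW (archi_boundP X0)) _; rewrite ler_nat.
    exact: leq_trans (leqnSn _) nn1.
  apply: le_trans (_ : n%:R <= _); last first.
    by rewrite ler_eXnr ?ler1n// muln_gt0.
  apply: le_trans nX; apply: ler_wpM2r; first by rewrite invr_ge0 ltW.
  rewrite ler_pM2l// lerXn2r ?nnegrE ?(ltW (bracket_gt0 R l))//.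
  by rewrite /bracket addrC natr1 ler_nat.
Qed.

End Separation.

(** * The region free of eigenvalues *)

Section Region.
Variables (R : realType) (m : nat).
Hypothesis m0 : (0 < m)%N.
Local Notation C := R[i].
Local Notation eig := (eig R m).

Definition mu (n : nat) : R := n%:R ^+ (2 * m) * pi ^+ (2 * m).

(** Abscissa of a vertical line between [mu n.-1] and [mu n], at a distance from
    both that is at least the radius of the corresponding disc *)
Definition gap (n : nat) : R := (n%:R ^+ (2 * m) - n%:R ^+ m) * pi ^+ (2 * m).

Lemma eig_mu k : eig k = mu (absz k).
Proof. by rewrite eigE. Qed.

Lemma pi_pow_ge1 : 1 <= pi ^+ (2 * m) :> R.
Proof. by rewrite exprn_ege1//; apply: le_trans (pi_ge2 R); rewrite ler1n. Qed.

Lemma pow2E (n : nat) : n%:R ^+ (2 * m) = n%:R ^+ m * n%:R ^+ m :> R.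
Proof. by rewrite mulnC exprM expr2. Qed.

Lemma mu_dist (a b : nat) :
  `|a%:R ^+ (2 * m) - b%:R ^+ (2 * m)| <= `|mu a - mu b|.
Proof.
have p1 := pi_pow_ge1.
rewrite /mu -mulrBl normrM ler_peMr// ger0_norm//.
exact: le_trans p1.
Qed.

Lemma mu_mono (a b : nat) : (a <= b)%N -> mu a <= mu b.
Proof.
move=> ab; have p1 := pi_pow_ge1; rewrite ler_wpM2r//; first exact: le_trans p1.
by rewrite lerXn2r ?nnegrE// ler_nat.
Qed.

Lemma gap_mu n : n%:R ^+ m <= mu n - gap n.
Proof.
have p1 := pi_pow_ge1; rewrite /mu /gap -mulrBl opprB addrC subrK.
by rewrite ler_peMr// exprn_ge0.
Qed.

Lemma mu_gap n : n%:R ^+ m <= gap n.+1 - mu n.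
Proof.
have p1 := pi_pow_ge1; rewrite /mu /gap -mulrBl.
have x0 : 0 <= n%:R ^+ m :> R by rewrite exprn_ge0.
suff h : n%:R ^+ m <= n.+1%:R ^+ (2 * m) - n.+1%:R ^+ m - n%:R ^+ (2 * m) :> R.
  by apply: (le_trans h); rewrite ler_peMr//; apply: le_trans h.
rewrite !pow2E; have : n%:R ^+ m + 1 <= n.+1%:R ^+ m :> R.
  by have := exprD_ge (ler0n R n) ler01 m0; rewrite expr1n natr1.
by move: x0; set x := n%:R ^+ m; set y := n.+1%:R ^+ m; nra.
Qed.

Lemma gap_mono (a b : nat) : (0 < a)%N -> (a <= b)%N -> gap a <= gap b.
Proof.
move=> a0 ab; have p1 := pi_pow_ge1; rewrite /gap ler_wpM2r//.
  exact: le_trans p1.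
rewrite !pow2E; have : a%:R ^+ m <= b%:R ^+ m :> R.
  by rewrite lerXn2r ?nnegrE// ler_nat.
have : 1 <= a%:R ^+ m :> R by rewrite exprn_ege1// ler1n.
by set x := a%:R ^+ m; set y := b%:R ^+ m; nra.
Qed.

Lemma gap_ge n : (0 < n)%N -> n%:R - 1 <= gap n.
Proof.
move=> n0; have p1 := pi_pow_ge1.
have x1 : n%:R <= n%:R ^+ m :> R by rewrite ler_eXnr// ler1n.
have n1 : 1 <= n%:R :> R by rewrite ler1n.
have h : n%:R - 1 <= n%:R ^+ (2 * m) - n%:R ^+ m :> R.
  by rewrite pow2E; move: x1 n1; set x := n%:R ^+ m; set y := n%:R; nra.
by apply: (le_trans h); rewrite ler_peMr//; apply: le_trans h; rewrite subr_ge0.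
Qed.

Lemma mu_sep (n a : nat) : a <> n -> n%:R ^+ m <= `|mu a - mu n|.
Proof.
move=> an; apply: le_trans (mu_dist a n); apply: le_trans (pow_diff R m0 a n).
have one : 1 <= `|a%:R - n%:R| :> R.
  have -> : `|a%:R - n%:R| = (absz (a%:Z - n%:Z)%R)%:R :> R.
    by rewrite [RHS]natr_absz intr_norm rmorphB.
  by rewrite ler1n; lia.
have h : n%:R ^+ m <= (maxn a n)%:R ^+ m :> R.
  by rewrite lerXn2r ?nnegrE// ler_nat leq_maxr.
by apply: le_trans h _; rewrite ler_peMl// exprn_ge0.
Qed.

(** Every other [mu a] is at least half as far from [Re z] as it is from the
    nearest point [mu n], so only the distance to [mu n] has to be controlled. *)
Lemma nearest_sep (n : nat) (z : C) :
  (forall a : nat, `|complex.Re z - mu n| <= `|complex.Re z - mu a|) ->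
  n%:R ^+ m <= nrm (z - (mu n)%:C) -> sep m n z.
Proof.
move=> hn hz k; rewrite eig_mu; set a := absz k.
have h1 b : `|complex.Re z - mu b| <= nrm ((mu b)%:C - z).
  by rewrite nrmB; apply: le_trans (Re_le_nrm _); rewrite ReB.
have h2 : `|mu a - mu n| <= 2 * nrm ((mu a)%:C - z).
  have := ler_normD (mu a - complex.Re z) (complex.Re z - mu n).
  rewrite addrA subrK [`|mu a - complex.Re z|]distrC.
  have := hn a; have := h1 a; lra.
split; last exact: le_trans (mu_dist a n) h2.
have [e|ne] := eqVneq a n.
  rewrite e nrmB; apply: le_trans hz _; rewrite mulr_natl mulr2n lerDl.
  exact: nrm_ge0.
by apply: le_trans (mu_sep _) h2; apply/eqP.
Qed.

Lemma nearest_exists (x : R) : mu 0 <= x ->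
  exists n : nat, forall a : nat, `|x - mu n| <= `|x - mu a|.
Proof.
move=> x0.
have ex : exists n : nat, 2 * x < mu n + mu n.+1.
  exists (Num.bound `|x|).+1.
  set n := (Num.bound _).+1.
  have xn : x <= n%:R.
    apply: le_trans (ler_norm x) _; apply: le_trans (ltW (archi_boundP _)) _ => //.
    by rewrite ler_nat /n.
  have nm : n%:R <= mu n.
    have p1 := pi_pow_ge1.
    have h : n%:R <= n%:R ^+ (2 * m) :> R.
      by rewrite ler_eXnr ?muln_gt0 ?m0// ler1n.
    by apply: le_trans h _; rewrite ler_peMr// exprn_ge0.
  have := mu_gap n; have := gap_mu n.+1.
  have : 0 < n.+1%:R ^+ m :> R by rewrite exprn_gt0.
  have : 0 < n%:R ^+ m :> R by rewrite exprn_gt0.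
  by lra.
case: (ex_minnP ex) => n hn hmin; exists n => a.
have lo : (0 < n)%N -> mu n.-1 + mu n <= 2 * x.
  case: n {hn} hmin => // n hmin _ /=; rewrite leNgt; apply/negP => /hmin.
  by rewrite ltnn.
have [an|an|->//] := ltngtP a n.
  have n1 : (0 < n)%N by apply: leq_trans an.
  have h : mu a <= mu n.-1 by apply: mu_mono; rewrite -ltnS prednK.
  have h' : mu n.-1 <= mu n by apply: mu_mono; apply: leq_pred.
  have := lo n1; have := ler_norm (x - mu a).
  by rewrite ler_norml; lra.
have h : mu n.+1 <= mu a by apply: mu_mono.
have h' : mu n <= mu n.+1 by apply: mu_mono.
have := ler_norm (mu a - x); rewrite [`|mu a - x|]distrC.
rewrite ler_norml => h3; apply/andP; split; last by lra.
case: n {hn hmin an ex} lo h h' => [|n] lo h h'; first by lra.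
have := lo isT => /= h4; lra.
Qed.

(** The nearest index can be [n0.-1], since for [m = 1] the line lies slightly to
    the left of the midpoint of [mu n0.-1] and [mu n0]. *)
Lemma sep_right (n0 : nat) (z : C) : (1 < n0)%N -> gap n0 <= complex.Re z ->
  (forall n, (n0 <= n)%N -> n%:R ^+ m <= nrm (z - (mu n)%:C)) ->
  exists2 n, (n0.-1 <= n)%N & sep m n z.
Proof.
move=> n01 hz hd.
have n0E : n0 = n0.-1.+1 by case: n0 n01 {hz hd}.
have h1 : n0.-1%:R ^+ m <= complex.Re z - mu n0.-1.
  have := mu_gap n0.-1; rewrite -n0E; lra.
have x0 : 0 <= n0.-1%:R ^+ m :> R by rewrite exprn_ge0.
have [n hn] : exists n, forall a, `|complex.Re z - mu n| <= `|complex.Re z - mu a|.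
  apply: nearest_exists; have := mu_mono (leq0n n0.-1); lra.
have nn : (n0.-1 <= n)%N.
  rewrite leqNgt; apply/negP => ln.
  have := hn n0.-1; have := mu_gap n; have := gap_mu n.+1.
  have : mu n.+1 <= mu n0.-1 by apply: mu_mono.
  have : 0 < n.+1%:R ^+ m :> R by rewrite exprn_gt0.
  have : 0 <= n%:R ^+ m :> R by rewrite exprn_ge0.
  have := ler_norm (complex.Re z - mu n).
  by rewrite [`|_ - mu n0.-1|]ger0_norm; lra.
exists n => //; apply: nearest_sep => //.
have [h|h] := leqP n0 n; first exact: hd.
have -> : n = n0.-1 by lia.
apply: le_trans h1 _; apply: le_trans (ler_norm _) _.
by apply: le_trans (Re_le_nrm _); rewrite ReB.
Qed.

(** Left of the cone [|eig k - z|] exceeds half of [eig k + M], whatever the size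
    of [Im z]. *)
Lemma sep_left (n0 : nat) (z : C) (M : R) : (0 < n0)%N ->
  n0%:R ^+ (2 * m) + n0%:R ^+ m <= M ->
  complex.Re z < `|complex.Im z| - M -> sep m n0 z.
Proof.
move=> n00 hM hz k; rewrite eig_mu; set a := absz k.
have h1 : `|complex.Im z| <= nrm ((mu a)%:C - z).
  by apply: le_trans (Im_le_nrm _); rewrite ImB sub0r normrN.
have h2 : mu a - complex.Re z <= nrm ((mu a)%:C - z).
  by apply: le_trans (Re_le_nrm _); rewrite ReB ler_norm.
have h3 : a%:R ^+ (2 * m) <= mu a.
  have p1 := pi_pow_ge1; by rewrite /mu ler_peMr// exprn_ge0.
have h4 : 0 <= a%:R ^+ (2 * m) :> R by rewrite exprn_ge0.
have h5 : 0 <= n0%:R ^+ (2 * m) :> R by rewrite exprn_ge0.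
have h6 : 0 <= n0%:R ^+ m :> R by rewrite exprn_ge0.
split; first by lra.
by rewrite ler_norml; apply/andP; split; lra.
Qed.

(** The discs lie between the corresponding lines, so the lines themselves are
    in the free region. *)
Lemma gap_sep (n0 n : nat) : (1 < n0)%N -> (n0 <= n)%N ->
  exists2 p, (n0.-1 <= p)%N & sep m p (gap n)%:C.
Proof.
move=> n01 nn; apply: sep_right => // [|a na].
  by apply: gap_mono => //; apply: ltnW.
rewrite -rmorphB/= nrm_real; have [h|h] := leqP n a.
  have := gap_mu a; have := gap_mono (_ : 0 < n)%N h.
  rewrite (leq_trans _ nn)// 1?ltnW// => /(_ isT) h1 h2.
  by rewrite distrC; apply: le_trans (ler_norm _); lra.
have := mu_gap a; have := @gap_mono a.+1 n isT h => h1 h2.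
by apply: le_trans (ler_norm _); lra.
Qed.

Lemma disc_unique (n0 n : nat) (z : C) : (0 < n0)%N -> (n0 <= n)%N ->
  gap n <= complex.Re z -> complex.Re z <= gap n.+1 ->
  forall a, (n0 <= a)%N -> nrm (z - (mu a)%:C) < a%:R ^+ m -> a = n.
Proof.
move=> n00 nn h1 h2 a na ha.
have := Re_le_nrm (z - (mu a)%:C); rewrite ReB/= => h3.
have h4 : `|complex.Re z - mu a| < a%:R ^+ m by apply: le_lt_trans ha.
move: h4; rewrite ltr_norml => /andP[h5 h6].
have [an|an|//] := ltngtP a n; exfalso.
  have := mu_gap a; have := @gap_mono a.+1 n isT an; lra.
have := gap_mu a; have := @gap_mono n.+1 a isT an; lra.
Qed.

End Region.

(** * Decoupling in Sobolev spaces *)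

Section SobolevGap.
Variables (R : realType) (m : nat).
Hypothesis m0 : (0 < m)%N.
Local Notation C := R[i].
Local Notation eig := (eig R m).
Local Notation br := (bracket R).

(** Under [sep] the scale [sqrt |lam - z|] is comparable to the weight of [H^m],
    so that the abstract form domain and its dual are [H^m] and [H^(-m)]. *)
Section Weights.
Variables (p : nat) (z : C).
Hypothesis p0 : (0 < p)%N.
Hypothesis hz : sep m p z.
Let D k := nrm ((eig k)%:C - z).
Let s k : C := (Num.sqrt (D k))%:C.

Lemma weight_s2 k : nrm (s k) ^+ 2 = D k.
Proof. by rewrite nrm_real real_normK ?num_real// sqr_sqrtr// nrm_ge0. Qed.

Lemma weight_lo : exists2 c : R, 0 <= c & forall k, br k ^+ m <= c * nrm (s k).
Proof.
pose c2 : R := 4 ^+ m * (2 * (1 + p%:R ^+ (2 * m)) + 2).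
have x0 : 0 <= p%:R ^+ (2 * m) :> R by rewrite exprn_ge0.
have f4 : 0 <= 4 ^+ m :> R by rewrite exprn_ge0.
have c0 : 0 <= c2 by apply: mulr_ge0 => //; lra.
exists (Num.sqrt c2); first exact: sqrtr_ge0.
move=> k; have b0 := bracket_gt0 R k.
rewrite -(@ler_pXn2r _ 2)// ?nnegrE ?mulr_ge0 ?sqrtr_ge0 ?nrm_ge0 ?exprn_ge0 ?(ltW b0)//.
rewrite exprMn sqr_sqrtr// weight_s2 -exprM [(m * 2)%N]mulnC.
have [h1 h2] := hz k; rewrite -/(D k) in h1 h2.
have p1 : 1 <= p%:R ^+ m :> R by rewrite exprn_ege1// ler1n.
set A := (absz k)%:R ^+ (2 * m) in h2; set X := p%:R ^+ (2 * m) in h2 x0 c2 c0 *.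
have hb : br k ^+ (2 * m) <= 4 ^+ m * (1 + A).
  have e4 : 2 ^+ (2 * m) = 4 ^+ m :> R by rewrite exprM -natrX.
  rewrite -e4; have [ka|ka] := posnP (absz k).
    have e1 : br k = 1 by rewrite /bracket ka addr0.
    rewrite e1 expr1n mulr_ege1//; last by rewrite lerDl exprn_ge0.
    by rewrite exprn_ege1// ler1n.
  apply: le_trans (_ : (2 * (absz k)%:R) ^+ (2 * m) <= _).
    rewrite lerXn2r ?nnegrE ?mulr_ge0 ?(ltW b0)// /bracket.
    by rewrite mulr_natl mulr2n lerD2r ler1n.
  by rewrite exprMn ler_wpM2l ?exprn_ge0// lerDr.
have hA : A <= X + 2 * D k by have := ler_norm (A - X); lra.
apply: le_trans hb _; rewrite /c2 -mulrA ler_wpM2l//.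
by move: x0 h1 p1 hA; set P := p%:R ^+ m; move: (D k) => d; nra.
Qed.

Lemma weight_hi : exists2 c : R, 0 <= c & forall k, nrm (s k) <= c * br k ^+ m.
Proof.
have p1 : 0 <= pi ^+ (2 * m) :> R by apply: le_trans (pi_pow_ge1 R m).
pose c2 : R := pi ^+ (2 * m) + nrm z.
have c0 : 0 <= c2 by rewrite addr_ge0// nrm_ge0.
exists (Num.sqrt c2); first exact: sqrtr_ge0.
move=> k; have b1 := bracket_ge1 R k; have b0 := bracket_gt0 R k.
rewrite -(@ler_pXn2r _ 2)// ?nnegrE ?mulr_ge0 ?sqrtr_ge0 ?nrm_ge0 ?exprn_ge0 ?(ltW b0)//.
rewrite weight_s2 exprMn sqr_sqrtr// -exprM [(m * 2)%N]mulnC.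
apply: le_trans (nrmD _ _) _; rewrite nrmN nrm_real /c2 mulrDl; apply: lerD.
  rewrite eigE ger0_norm; last by apply: mulr_ge0 => //; apply: exprn_ge0.
  rewrite mulrC ler_wpM2l//.
  by rewrite lerXn2r ?nnegrE ?(ltW b0)// /bracket lerDr.
by rewrite ler_peMr ?nrm_ge0// exprn_ege1.
Qed.

Lemma weight_s_neq0 k : 0 < nrm (s k).
Proof.
have [c c0 h] := weight_lo.
rewrite lt_neqAle nrm_ge0 andbT eq_sym; apply/eqP => e.
have := h k; rewrite e mulr0 leNgt exprn_gt0//.
exact: bracket_gt0.
Qed.

Lemma sobolev_scaled (f : fourier R) :
  sobolev m%:R f <-> exists r, l2 (fun k => s k * f k) r.
Proof.
have [c c0 hc] := weight_lo; have [c' c'0 hc'] := weight_hi.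
have e k : nrm ((br k `^ m%:R)%:C * f k) = br k ^+ m * nrm (f k).
  have b0 := bracket_gt0 R k.
  by rewrite nrmM nrm_real powR_mulrn ?ltW// ger0_norm// exprn_ge0// ltW.
rewrite sobolevP; split=> -[r hr].
  exists (c' * r); apply: l2_domZ hr => // k.
  by rewrite e mulrA nrmM ler_wpM2r ?nrm_ge0.
exists (c * r); apply: l2_domZ hr => // k.
by rewrite e nrmM mulrA ler_wpM2r ?nrm_ge0.
Qed.

Lemma weight_dual : exists2 c : R, 0 <= c & forall (g : fourier R) r,
  l2 (fun k => (br k `^ (- m%:R))%:C * g k) r -> l2 (fun k => g k / s k) (c * r).
Proof.
have [c c0 hc] := weight_lo; exists c => // f r; apply: l2_domZ => // k.
have b0 : 0 < br k ^+ m by rewrite exprn_gt0// bracket_gt0.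
rewrite !nrmM nrmV nrm_real powR_invn ?(ltW (bracket_gt0 R k))//.
rewrite ger0_norm ?invr_ge0 ?(ltW b0)// mulrA mulrC ler_wpM2r ?nrm_ge0//.
rewrite -[(nrm (s k))^-1]div1r ler_pdivrMr ?weight_s_neq0//.
by rewrite mulrAC ler_pdivlMr// mul1r.
Qed.

Lemma weight_neg : exists2 c : R, 0 <= c & forall (f : fourier R) r,
  l2 (fun k => s k * f k) r -> l2 (fun k => (br k `^ (- m%:R))%:C * f k) (c * r).
Proof.
have [c c0 hc] := weight_lo; exists c => // f r; apply: l2_domZ => // k.
have b1 : 1 <= br k ^+ m by rewrite exprn_ege1// bracket_ge1.
have b0 : 0 < br k ^+ m by rewrite exprn_gt0// bracket_gt0.
rewrite !nrmM nrm_real powR_invn ?(ltW (bracket_gt0 R k))//.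
rewrite ger0_norm ?invr_ge0 ?(ltW b0)// mulrA ler_wpM2r ?nrm_ge0//.
by apply: le_trans (hc k); apply: (le_trans _ b1); rewrite invf_le1.
Qed.

Lemma no_eigenvalue (W f : fourier R) :
  hs (fun k j => W (k - j) / (s k * s j)) 8^-1 -> sobolev m%:R f ->
  L_shift m W z f = (fun=> 0) -> f = (fun=> 0).
Proof.
move=> hb /sobolev_scaled[r hf]; rewrite L_shiftE.
have D0 k : 0 < nrm ((eig k)%:C - z) by exact: (sep_D_gt0 p0 hz k).
have q1 : 8^-1 < 1 :> R by lra.
exact: (no_eigenvector D0 q1 hb hf).
Qed.

End Weights.

(** What the rest of the proof uses of the gap at [x0]: [u] is a basis of an
    invariant subspace, [G] the matrix of [L] on it, acting on rows of
    coordinates. *)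
Record decoupled (W : fourier R) (x0 : R) (N : nat)
    (G : 'M[C]_N) (u : 'I_N -> fourier R) : Prop := Decoupled {
  dec_dom : forall i, sobolev m%:R (u i);
  dec_inj : forall a, lincomb u a = (fun=> 0) -> a = 0;
  dec_shift : forall z a,
    L_shift m W z (lincomb u a) = lincomb u (a *m (G - z%:M));
  dec_preimage : forall z f a, complex.Re z <= x0 -> sobolev m%:R f ->
    L_shift m W z f = lincomb u a -> exists c, f = lincomb u c;
  dec_block : forall z (a : 'rV_N), x0 <= complex.Re z ->
    a *m (G - z%:M) = 0 -> a = 0;
  dec_resolvent : forall z, complex.Re z <= x0 -> G - z%:M \in unitmx ->
    resolvent_set m W z
}.

Theorem sobolev_gap (W : fourier R) (n p : nat) :
  (1 < n)%N -> (0 < p)%N -> sep m p (gap R m n)%:C ->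
  let s k := (Num.sqrt (nrm ((eig k)%:C - (gap R m n)%:C)))%:C in
  hs (fun k j => W (k - j) / (s k * s j)) 8^-1 ->
  exists G u, @decoupled W (gap R m n) (n.-1.*2.+1) G u.
Proof.
move=> n1 p0 hsep s hb; set x0 := gap R m n.
have nE : n = n.-1.+1 by case: n n1 {x0 hsep s hb}.
have lam_lo k : (absz k <= n.-1)%N -> eig k < x0.
  move=> kn; rewrite eig_mu; apply: le_lt_trans (mu_mono R m kn) _.
  have := mu_gap R m0 n.-1; rewrite -nE -/x0.
  have : 0 < n.-1%:R ^+ m :> R by rewrite exprn_gt0// ltr0n; lia.
  by lra.
have lam_hi k : ~~ (absz k <= n.-1)%N -> x0 < eig k.
  move=> kn; rewrite eig_mu; apply: lt_le_trans (mu_mono R m (_ : n <= absz k)%N).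
    have := gap_mu R m n; rewrite -/x0.
    have : 0 < n%:R ^+ m :> R by rewrite exprn_gt0// ltr0n; lia.
    by lra.
  by lia.
have sE k : s k = (Num.sqrt `|eig k - x0|)%:C.
  by rewrite /s -rmorphB/= nrm_real.
have hb' : hs (fun k j => W (k - j) / ((Num.sqrt `|eig k - x0|)%:C * (Num.sqrt `|eig j - x0|)%:C)) 8^-1.
  by apply: l2_dom hb => -[k j] /=; rewrite !sE.
have domE f : sobolev m%:R f <-> dom eig x0 f.
  rewrite (sobolev_scaled p0 hsep); split=> -[r hr]; exists r;
    by apply: l2_dom hr => k; rewrite -[(Num.sqrt `|_|)%:C]sE.
have [G [u [udom uinj ushift [upre ublock usolve ubound]]]] :=
  gap_decoupling lam_lo lam_hi hb'.
exists G, u; split.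
- by move=> i; apply/domE.
- exact: uinj.
- by move=> z a; rewrite L_shiftE; apply: ushift.
- by move=> z f a hz /domE df; rewrite L_shiftE; apply: upre.
- exact: ublock.
move=> z hz Gu; have [K K0 hK] := ubound z hz Gu.
have [c c0 hc] := weight_dual p0 hsep; have [c' c'0 hc'] := weight_neg p0 hsep.
split.
  move=> g /sobolevP[r /hc hr].
  have hr' : l2 (fun k => g k / (Num.sqrt `|eig k - x0|)%:C) (c * r).
    by apply: l2_dom hr => k; rewrite -sE.
  have [f df fg] := usolve z g _ hz Gu hr'.
  exists f; split; first by split; [exact/domE|rewrite L_shiftE].
  move=> f' [/domE df' f'g]; rewrite L_shiftE in f'g.
  have dfB := domB df df'.
  have sB : shift eig (fun k j => W (k - j)) z (fun k => f k - f' k) = fun=> 0.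
    have h := shiftD lam_lo lam_hi hb' z dfB df'.
    apply/funext => k; have := congr1 (fun F => F k) h.
    under [X in shift _ _ _ X]eq_fun do rewrite subrK.
    by rewrite /= fg f'g => /eqP; rewrite -subr_eq subrr eq_sym => /eqP.
  have h0 : l2 (fun k => shift eig (fun k j => W (k - j)) z (fun k => f k - f' k) k /
      (Num.sqrt `|eig k - x0|)%:C) 0.
    by rewrite sB; apply: l2_dom (l2_zero _ (lexx 0)) => k; rewrite mul0r.
  have := hK _ _ dfB h0; rewrite mulr0 => /l2_0_eq h.
  apply/funext => k; have /= /eqP := congr1 (fun F => F k) h.
  rewrite -sE mulf_eq0 subr_eq0 => /orP[/eqP s0|/eqP //].
  by have := weight_s_neq0 p0 hsep k; rewrite -/(s k) s0 nrm0 ltxx.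
exists (c' * (K * c) + 1) => f /domE df.
have Kc : 0 <= c' * (K * c) by rewrite !mulr_ge0.
set g := L_shift m W z f.
have : (0 <= sobolev_norm (- m%:R) g)%E by exact: poweR_ge0.
case E : (sobolev_norm (- m%:R) g) => [r| |]//; last first.
  by rewrite gt0_muley ?leey// lte_fin ltr_wpDl.
rewrite lee_fin => r0; rewrite -EFinM; apply/sobolev_norm_le.
  by rewrite mulr_ge0// addr_ge0.
have /hc hg : l2 (fun k => (br k `^ (- m%:R))%:C * g k) r.
  by apply/sobolev_norm_le => //; rewrite E.
have hg' : l2 (fun k => shift eig (fun k j => W (k - j)) z f k /
    (Num.sqrt `|eig k - x0|)%:C) (c * r).
  by rewrite -L_shiftE -/g; apply: l2_dom hg => k; rewrite -sE.
have hf : l2 (fun k => s k * f k) (K * (c * r)).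
  by apply: l2_dom (hK _ _ df hg') => k; rewrite -sE.
apply: (l2_mono (hc' _ _ hf)).
by rewrite mulrDl mul1r !mulrA lerDl.
Qed.

End SobolevGap.

(** * Generalized eigenspaces of a matrix *)

Section GeneralizedEigenspaces.
Variables (F : closedFieldType) (k : nat) (G : 'M[F]_k.+1).

Lemma horner_XsubC_exp z j :
  horner_mx G (('X - z%:P) ^+ j) = (G - z%:M) ^+ j.
Proof. by rewrite rmorphXn/= rmorphB/= horner_mx_X horner_mx_C. Qed.

(** The kernels of the powers of [G - z] stop growing at the exponent [k.+1]:
    the cofactor of [('X - z) ^+ mu] in the characteristic polynomial is
    coprime to every power of ['X - z]. *)
Lemma ker_pow_stable z j (v : 'rV_k.+1) :
  v *m (G - z%:M) ^+ j = 0 -> (v <= geigenspace G z)%MS.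
Proof.
move=> vj; rewrite geigenspaceE; apply/sub_kermxP.
have [mu [q]] := multiplicity_XsubC (char_poly G) z.
have p0 : char_poly G != 0 by rewrite -size_poly_gt0 size_char_poly.
rewrite p0/= => qz qE.
have mun : (mu <= k.+1)%N.
  have := dvdp_leq p0 (_ : ('X - z%:P) ^+ mu %| char_poly G).
  rewrite size_char_poly size_exp_XsubC ltnS; apply.
  by rewrite qE dvdp_mull.
pose w := v *m (G - z%:M) ^+ mu.
have wq : (w <= kermxpoly G q)%MS.
  apply/sub_kermxP; rewrite /w -horner_XsubC_exp -mulmxA mulmxE -rmorphM mulrC -qE.
  by rewrite /= Cayley_Hamilton mulmx0.
have wj : (w <= kermxpoly G (('X - z%:P) ^+ j))%MS.
  apply/sub_kermxP; rewrite /w horner_XsubC_exp -mulmxA mulmxE -exprD addnC exprD.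
  by rewrite -mulmxE mulmxA vj mul0mx.
have cop : coprimep q (('X - z%:P) ^+ j).
  by rewrite coprimep_expr// coprimep_XsubC.
have w0 : w = 0.
  apply/eqP; rewrite -submx0 -(mxdirect_kermxpoly G cop).
  by rewrite sub_capmx wq.
have -> : (G - z%:M) ^+ k.+1 = (G - z%:M) ^+ mu * (G - z%:M) ^+ (k.+1 - mu).
  by rewrite -exprD subnKC.
by rewrite -mulmxE mulmxA -/w w0 mul0mx.
Qed.

Lemma geigenspace_unit z :
  (\rank (geigenspace G z) == 0)%N = (G - z%:M \in unitmx).
Proof.
apply/idP/idP => [r0|Gu].
  rewrite -row_free_unit -kermx_eq0 -submx0.
  rewrite mxrank_eq0 in r0; rewrite -(eqP r0).
  exact: eigenspace_sub_geigen.
by rewrite geigenspaceE mxrank_eq0 kermx_eq0 row_free_unit unitrX.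
Qed.

(** By Cayley--Hamilton the kernel of [char_poly G] is the whole space, and it
    is the direct sum of the kernels of its coprime factors. *)
Lemma sum_rank_geigenspace : exists S : seq F,
  [/\ uniq S, forall z, z \notin S -> \rank (geigenspace G z) = 0%N &
      (\sum_(z <- S) \rank (geigenspace G z) = k.+1)%N].
Proof.
have [r rE] := closed_field_poly_normal (char_poly G).
have /eqP lc : char_poly G \is monic by exact: char_poly_monic.
rewrite lc scale1r in rE.
exists (undup r); split; first exact: undup_uniq.
  move=> z; rewrite mem_undup => zr; apply/eqP; rewrite geigenspace_unit.
  rewrite -row_free_unit -kermx_eq0; apply/negPn.
  rewrite -[_ != 0]/(eigenvalue G z) eigenvalue_root_char rE.
  by rewrite root_prod_XsubC.
set S := undup r.
pose a (i : 'I_(size S)) := S`_i.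
have ainj : injective a.
  move=> i j /eqP; rewrite /a nth_uniq ?undup_uniq//.
  by move/eqP/val_inj.
have dir := mxdirect_sum_geigenspace G (in2W ainj : {in xpredT &, injective a}).
rewrite (big_nth 0) big_mkord.
have {dir} := mxdirectP dir; rewrite /= => <-.
apply/eqP; rewrite eqn_leq rank_leq_row/=.
rewrite -[leqLHS](mxrank1 F) mxrankS//.
apply: submx_trans (_ : (\sum_i kermxpoly G (('X - (a i)%:P) ^+ count_mem (a i) r) <= _)%MS).
  rewrite -kermxpoly_prod; last first.
    move=> i j _ _ ij; rewrite coprimep_expr// coprimep_expl// coprimep_XsubC.
    by rewrite root_XsubC (inj_eq ainj).
  apply/sub_kermxP; rewrite mul1mx.
  suff -> : \prod_i ('X - (a i)%:P) ^+ count_mem (a i) r = char_poly G.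
    exact: Cayley_Hamilton.
  rewrite rE -[RHS](prodr_undup_exp_count r xpredT).
  by rewrite (big_nth 0) big_mkord.
apply/sumsmx_subP => i _; apply: submx_trans (sumsmx_sup i _ (submx_refl _)) => //.
apply/row_subP => l; apply: (@ker_pow_stable _ (count_mem (a i) r)).
rewrite -horner_XsubC_exp; apply/sub_kermxP; exact: row_sub.
Qed.

End GeneralizedEigenspaces.

(** * Root spaces left of a gap *)

Section Dimension.
Variable R : realType.
Local Notation C := R[i].

(** The two coordinate matrices satisfy [X *m Y = 1]. *)
Lemma indep_span_le (d e : nat) (b : 'I_d -> fourier R) (c : 'I_e -> fourier R) :
  (forall x : 'I_d -> C,
    (fun k => \sum_(i < d) x i * b i k) = (fun=> 0) -> forall i, x i = 0) ->
  (forall i, exists x : 'I_e -> C, b i = fun k => \sum_(j < e) x j * c j k) ->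
  (forall j, exists x : 'I_d -> C, c j = fun k => \sum_(i < d) x i * b i k) ->
  (d <= e)%N.
Proof.
move=> ind /choice[x xE] /choice[y yE].
apply: (@mulmx1_min C d e (\matrix_(i, j) x i j) (\matrix_(j, i) y j i)).
apply/matrixP => i l; rewrite !mxE; apply/eqP; rewrite -subr_eq0; apply/eqP.
under eq_bigr do rewrite !mxE.
apply: (ind (fun l => \sum_j x i j * y j l - (i == l)%:R)).
apply/funext => k; under eq_bigr do rewrite mulrBl.
rewrite sumrB [X in _ - X](bigD1 i)//= eqxx mul1r [X in _ - (_ + X)]big1 => [|p pi]; last first.
  by rewrite eq_sym (negbTE pi) mul0r.
rewrite addr0; apply/eqP; rewrite subr_eq0; apply/eqP.
rewrite [RHS](congr1 (fun f => f k) (xE i)).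
under eq_bigr do rewrite mulr_suml.
rewrite exchange_big/=; apply: eq_bigr => j _.
rewrite [in RHS](congr1 (fun f => f k) (yE j)) mulr_sumr.
by apply: eq_bigr => p _; rewrite mulrA.
Qed.

Lemma has_dim_mem (S : set (fourier R)) (d : nat) (b : 'I_d -> fourier R) :
  S = [set f | exists c : 'I_d -> C, f = (fun k => \sum_(i < d) c i * b i k)] ->
  forall i, S (b i).
Proof.
move=> -> i; exists (fun j => (i == j)%:R); apply/funext => k.
rewrite (bigD1 i)//= eqxx mul1r big1 ?addr0// => j ji.
by rewrite eq_sym (negbTE ji) mul0r.
Qed.

Lemma has_dim_uniq (S : set (fourier R)) (d e : nat) :
  has_dim S d -> has_dim S e -> d = e.
Proof.
move=> [b [bi bS]] [c [ci cS]].
have bc i : exists x : 'I_e -> C, b i = fun k => \sum_(j < e) x j * c j k.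
  by have := has_dim_mem bS i; rewrite cS.
have cb j : exists x : 'I_d -> C, c j = fun k => \sum_(i < d) x i * b i k.
  by have := has_dim_mem cS j; rewrite bS.
apply/eqP; rewrite eqn_leq (indep_span_le bi bc cb).
exact: (indep_span_le ci cb bc).
Qed.

End Dimension.

Section RootSpaces.
Variables (R : realType) (m : nat) (W : fourier R) (x0 : R) (N : nat).
Local Notation C := R[i].
Variables (G : 'M[C]_N.+1) (u : 'I_N.+1 -> fourier R).
Hypothesis dec : decoupled m W x0 G u.

Lemma lincomb0 : lincomb u 0 = fun=> 0.
Proof. by apply/funext => k; rewrite /lincomb big1// => i _; rewrite mxE mul0r. Qed.

Lemma lincomb_mul (d : nat) (c : 'I_d -> C) (A : 'M[C]_(d, N.+1)) :
  lincomb u ((\row_i c i) *m A) = fun k => \sum_(i < d) c i * lincomb u (row i A) k.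
Proof.
apply/funext => k; rewrite /lincomb.
under [RHS]eq_bigr do rewrite mulr_sumr.
rewrite exchange_big/=; apply: eq_bigr => j _.
rewrite mxE mulr_suml; apply: eq_bigr => i _.
by rewrite !mxE mulrA.
Qed.

Lemma sobolev_lincomb a : sobolev m%:R (lincomb u a).
Proof.
have h i : exists r, l2 (fun k => (bracket R k `^ m%:R)%:C * u i k) r.
  exact: (sobolevP _ _).1 (dec_dom dec i).
have [r hr] := choice h.
apply/sobolevP; eexists.
apply: l2_dom (l2_sum (index_enum _) (fun i => l2Z (a 0 i) (hr i))) => k.
rewrite /lincomb mulr_sumr; under [X in _ <= nrm X]eq_bigr do rewrite mulrCA.
exact: lexx.
Qed.

Lemma lincomb_inj a b : lincomb u a = lincomb u b -> a = b.
Proof.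
move=> h; apply/eqP; rewrite -subr_eq0; apply/eqP; apply: (dec_inj dec).
apply/funext => k; have := congr1 (fun f => f k) h => /eqP.
rewrite -subr_eq0 /lincomb -sumrB => /eqP e; rewrite -[RHS]e.
by apply: eq_bigr => i _; rewrite !mxE mulrBl.
Qed.

(** Each step of a chain that ends in the invariant subspace stays in it, by
    [dec_preimage]; so the root space is seen by the matrix [G] alone. *)
Lemma ker_powP z j (f : fourier R) : complex.Re z <= x0 ->
  ker_pow m W z j f <-> exists a, f = lincomb u a /\ a *m (G - z%:M) ^+ j = 0.
Proof.
move=> hz; elim: j f => [|j IH] f /=.
  rewrite expr0; split=> [->|[a [-> ]]].
    by exists 0; rewrite lincomb0 mul0mx.
  by rewrite mulmx1 => ->; rewrite lincomb0.
split=> [[sf /IH[c [e c0]]]|[a [-> a0]]].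
  have [a fa] := dec_preimage dec hz sf e; exists a; split=> //.
  move: e; rewrite fa (dec_shift dec) => /lincomb_inj e.
  by rewrite exprS -mulmxE mulmxA e c0.
split; first exact: sobolev_lincomb.
apply/IH; exists (a *m (G - z%:M)); rewrite (dec_shift dec); split=> //.
by move: a0; rewrite exprS -mulmxE mulmxA.
Qed.

Lemma root_spaceP z (f : fourier R) : complex.Re z <= x0 ->
  root_space m W z f <->
  exists a, f = lincomb u a /\ (a <= geigenspace G z)%MS.
Proof.
move=> hz; split=> [[j _ /(ker_powP _ _ hz)[a [-> a0]]]|[a [-> ag]]].
  by exists a; split=> //; apply: ker_pow_stable a0.
exists N.+1 => //; apply/(ker_powP _ _ hz); exists a; split=> //.
by move: ag; rewrite geigenspaceE => /sub_kermxP.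
Qed.

Lemma rank_multiplicity z : complex.Re z <= x0 ->
  alg_multiplicity m W z (\rank (geigenspace G z)).
Proof.
move=> hz; set E := geigenspace G z; set d := \rank E.
exists (fun i : 'I_d => lincomb u (row i (row_base E))); split.
  move=> c; rewrite -lincomb_mul => /(dec_inj dec) h i.
  have /row_freeP[B hB] := row_base_free E.
  have := congr1 (fun X => (X *m B) 0 i) h.
  by rewrite mul0mx -mulmxA hB mulmx1 !mxE.
apply/seteqP; split=> f /=.
  move=> /(root_spaceP _ hz)[a [-> aE]].
  have /submxP[c cE] : (a <= row_base E)%MS by rewrite eq_row_base.
  exists (fun i => c 0 i); rewrite -lincomb_mul cE; congr (lincomb _ (_ *m _)).
  by apply/rowP => i; rewrite mxE.
move=> [c ->]; apply/(root_spaceP _ hz); rewrite -lincomb_mul; eexists; split=> //.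
by apply: submx_trans (submxMl _ _) _; rewrite eq_row_base.
Qed.

Lemma rank_resolvent z : complex.Re z <= x0 -> \rank (geigenspace G z) = 0%N ->
  resolvent_set m W z.
Proof.
by move=> hz /eqP; rewrite geigenspace_unit; apply: (dec_resolvent dec).
Qed.

Lemma rank_eigenvector z : (0 < \rank (geigenspace G z))%N ->
  exists2 a : 'rV_N.+1, a != 0 & a *m (G - z%:M) = 0.
Proof.
rewrite lt0n geigenspace_unit -row_free_unit -kermx_eq0 => /rowV0Pn[a ak a0].
by exists a => //; apply/sub_kermxP.
Qed.

Lemma rank_eigenvalue z : (0 < \rank (geigenspace G z))%N ->
  Defs.eigenvalue m W z.
Proof.
move=> /rank_eigenvector[a a0 e]; exists (lincomb u a); split.
- exact: sobolev_lincomb.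
- by move=> /(dec_inj dec) h; rewrite h eqxx in a0.
- by rewrite (dec_shift dec) e lincomb0.
Qed.

Lemma rank_left z : (0 < \rank (geigenspace G z))%N -> complex.Re z < x0.
Proof.
move=> /rank_eigenvector[a a0 e]; rewrite ltNge; apply/negP => hz.
by have := dec_block dec hz e => h; rewrite h eqxx in a0.
Qed.

End RootSpaces.

Lemma eigenvalue_spectrum (R : realType) (m : nat) (W : fourier R) (z : R[i]) :
  Defs.eigenvalue m W z -> spectrum m W z.
Proof.
move=> [f [sf f0 e]] [h _].
have s0 (s : R) : sobolev s (fun=> 0 : R[i]).
  by apply/sobolevP; exists 0; apply: l2_dom (l2_zero _ (lexx 0)) => k; rewrite mulr0.
have [f' [_ fu]] := h _ (s0 _).
apply: f0; rewrite -(fu f)//; apply: fu; split=> //.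
apply/funext => k; rewrite /L_shift LE /opL /mv !mulr0 add0r subr0.
by rewrite (@int_sum_fin _ [::]) ?big_nil// => i _; rewrite mulr0.
Qed.

(** * Enumerating a multiset of complex numbers *)

Section Lexicographic.
Variable R : realType.
Local Notation C := R[i].

Definition lexC (z w : C) : bool :=
  (complex.Re z < complex.Re w) ||
  ((complex.Re z == complex.Re w) && (complex.Im z <= complex.Im w)).

Lemma lexC_total : total lexC.
Proof.
move=> z w; rewrite /lexC [complex.Re w == _]eq_sym.
by case: ltgtP => //= _; apply: le_total.
Qed.

Lemma lexC_trans : transitive lexC.
Proof.
move=> w z v; rewrite /lexC.
case/orP => [zw|/andP[/eqP -> zw]] /orP[wv|/andP[/eqP wv wv']].
- by rewrite (lt_trans zw wv).
- by rewrite -wv zw.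
- by rewrite wv.
- by rewrite wv eqxx (le_trans zw wv') orbT.
Qed.

Lemma lexC_anti : antisymmetric lexC.
Proof.
move=> [a b] [c d]; rewrite /lexC/= [c == a]eq_sym.
case: ltgtP => //= -> h; congr (_ +i* _); exact: le_anti.
Qed.

Lemma card_nth (s : seq C) (z : C) :
  [set k | (k < size s)%N /\ nth 0 s k = z] #= `I_(count_mem z s).
Proof.
elim/last_ind: s => [|s w IH].
  rewrite (_ : [set _ | _] = `I_0) ?card_eqxx//.
  by apply/seteqP; split=> k //= [].
rewrite -cats1 count_cat/= addn0; have [->|wz] := eqVneq w z.
  rewrite addn1; apply/eq_cardSP; exists (size s).
    by rewrite /= size_cat/= addn1 ltnS leqnn nth_cat ltnn subnn.
  rewrite (_ : _ `\ _ = [set k | (k < size s)%N /\ nth 0 s k = z])//.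
  apply/seteqP; split=> k /=.
    rewrite size_cat/= addn1 ltnS nth_cat => -[[ks kz] kn].
    have ks' : (k < size s)%N by rewrite ltn_neqAle ks andbT; apply/eqP.
    by rewrite ks' in kz.
  move=> [ks kz]; rewrite size_cat/= addn1 ltnS ltnW// nth_cat ks.
  by split=> // e; rewrite e ltnn in ks.
rewrite addn0 (_ : [set _ | _] = [set k | (k < size s)%N /\ nth 0 s k = z])//.
apply/seteqP; split=> k /=; rewrite size_cat/= addn1 ltnS nth_cat.
  move=> [ks]; have [//|sk] := ltnP k (size s).
  have -> : k = size s by apply/eqP; rewrite eqn_leq ks.
  by rewrite subnn/= => e; rewrite e eqxx in wz.
by move=> [ks kz]; rewrite ks ltnW.
Qed.

End Lexicographic.

(** The lists [E n], each of the eigenvalues left of the [n]-th line, determine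
    a single sequence, of which they are initial segments. *)
Section Enumeration.
Variables (R : realType) (x : nat -> R) (n0 : nat) (E : nat -> seq R[i]).
Local Notation C := R[i].
Hypothesis n0_gt0 : (0 < n0)%N.
Hypothesis x_mono : forall n p, (n0 <= n)%N -> (n <= p)%N -> x n <= x p.
Hypothesis x_unbounded : forall B : R, exists2 n, (n0 <= n)%N & B <= x n.
Hypothesis E_sorted : forall n, (n0 <= n)%N -> sorted (@lexC R) (E n).
Hypothesis E_size : forall n, (n0 <= n)%N -> size (E n) = n.-1.*2.+1.
Hypothesis E_lt : forall n z, (n0 <= n)%N -> z \in E n -> complex.Re z < x n.
Hypothesis E_count : forall n z, (n0 <= n)%N -> complex.Re z <= x n ->
  count_mem z (E n.+1) = count_mem z (E n).

(** The list [E (n0 + k)] has more than [k] entries, so the default value is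
    never read. *)
Definition enumC (k : nat) : C := nth 0 (E (n0 + k)) k.

(** Filtering a sorted list by [Re z <= x n] cuts off an initial segment, and the
    multiplicities identify it with [E n]. *)
Lemma E_split n : (n0 <= n)%N -> exists2 X : seq C, E n.+1 = E n ++ X &
  forall z, z \in X -> x n < complex.Re z.
Proof.
move=> nn; pose p (z : C) := complex.Re z <= x n.
have nn' : (n0 <= n.+1)%N by apply: leqW.
have pw (s : seq C) : pairwise (@lexC R) s = sorted (@lexC R) s.
  by rewrite sorted_pairwise//; apply: lexC_trans.
exists (seq.filter (predC p) (E n.+1)); last first.
  by move=> z; rewrite mem_filter/= -ltNge => /andP[].
have e1 : seq.filter p (E n.+1) = E n.
  apply: (sorted_eq (@lexC_trans R) (@lexC_anti R)).
  - by apply: sorted_filter (@lexC_trans R) _ _ _; apply: E_sorted.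
  - exact: E_sorted.
  apply/allP => z _ /=; apply/eqP; rewrite count_filter.
  have [pz|pz] := boolP (p z).
    rewrite -(E_count nn pz); apply: eq_count => y /=.
    by case: eqP => // ->; rewrite pz.
  rewrite (_ : count _ _ = 0%N); last first.
    rewrite -(count_pred0 (E n.+1)); apply: eq_count => y /=.
    by case: eqP => //= ->; apply/negbTE.
  apply/esym/count_memPn; apply: contra pz => /(E_lt nn).
  exact: ltW.
rewrite -{1}e1; apply: (sorted_eq (@lexC_trans R) (@lexC_anti R)).
- exact: E_sorted.
- rewrite -pw pairwise_cat !pairwise_filter ?pw ?E_sorted// andbT.
  rewrite andbT; apply/allrelP => y z; rewrite !mem_filter /p/= -ltNge.
  move=> /andP[h1 _] /andP[h2 _].
  by rewrite /lexC (le_lt_trans h1 h2).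
- by rewrite perm_sym perm_filterC.
Qed.

Lemma E_prefix n p : (n0 <= n)%N -> (n <= p)%N -> forall k,
  (k < size (E n))%N -> nth 0 (E p) k = nth 0 (E n) k.
Proof.
move=> nn; elim: p => [|p IH]; first by rewrite leqn0 => /eqP ->.
rewrite leq_eqVlt => /orP[/eqP -> //|]; rewrite ltnS => np k kn.
have [X -> _] := E_split (leq_trans nn np).
rewrite nth_cat IH// ifT//; apply: leq_trans kn _.
by rewrite !E_size ?(leq_trans nn np)// ltnS leq_double; lia.
Qed.

Lemma enumCE n k : (n0 <= n)%N -> (k < n.-1.*2.+1)%N -> enumC k = nth 0 (E n) k.
Proof.
move=> nn kn; rewrite /enumC.
have [h|/ltnW h] := leqP n (n0 + k).
  by rewrite (E_prefix nn h)// E_size.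
apply/esym; apply: E_prefix => //; first exact: leq_addr.
by rewrite E_size ?leq_addr//; lia.
Qed.

Lemma enumC_mem n k : (n0 <= n)%N -> (k < n.-1.*2.+1)%N -> enumC k \in E n.
Proof. by move=> nn kn; rewrite (enumCE nn kn) mem_nth// E_size. Qed.

Lemma enumC_lt n k : (n0 <= n)%N -> (k < n.-1.*2.+1)%N ->
  complex.Re (enumC k) < x n.
Proof. by move=> nn kn; apply: E_lt (enumC_mem nn kn). Qed.

Lemma E_gt n p k : (n0 <= n)%N -> (n <= p)%N ->
  (n.-1.*2.+1 <= k)%N -> (k < p.-1.*2.+1)%N -> x n < complex.Re (nth 0 (E p) k).
Proof.
move=> nn np kn; elim: p np => [|p IH] np kp; first by lia.
have [e|ne] := eqVneq n p.+1; first by rewrite -e in kp; lia.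
have {}np : (n <= p)%N by lia.
have pn : (n0 <= p)%N by lia.
have [kp'|kp'] := ltnP k p.-1.*2.+1.
  by rewrite (@E_prefix p p.+1)// ?E_size//; apply: IH.
have [X EX hX] := E_split pn.
apply: le_lt_trans (x_mono nn np) (hX _ _).
rewrite EX nth_cat E_size// ltnNge kp'/= mem_nth//.
have : size (E p.+1) = (size (E p) + size X)%N by rewrite EX size_cat.
rewrite !E_size ?leqW//; move: (size X) => t; clear -kp kp' n0_gt0 pn; lia.
Qed.

Lemma enumC_gt n k : (n0 <= n)%N -> (n.-1.*2.+1 <= k)%N ->
  x n < complex.Re (enumC k).
Proof.
move=> nn kn; have kp : (k < (n + k).-1.*2.+1)%N by lia.
rewrite (@enumCE (n + k))//; last by lia.
by apply: E_gt => //; apply: leq_addr.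
Qed.

Lemma enumC_cvg : complex.Re (enumC k) @[k --> \oo] --> +oo.
Proof.
apply/cvgryPge => B; have [n nn hB] := x_unbounded B.
exists n.-1.*2.+1 => // k /= kn; apply: ltW; apply: le_lt_trans hB _.
exact: enumC_gt.
Qed.

Lemma enumC_lex k : lexC (enumC k) (enumC k.+1).
Proof.
have nn : (n0 <= n0 + k.+1)%N by apply: leq_addr.
rewrite !(@enumCE (n0 + k.+1))//; try lia.
have := E_sorted nn; move/(sortedP 0); apply; rewrite E_size//; lia.
Qed.

Lemma enumC_card n z : (n0 <= n)%N -> complex.Re z <= x n ->
  [set k | enumC k = z] #= `I_(count_mem z (E n)).
Proof.
move=> nn hz.
rewrite (_ : [set _ | _] = [set k | (k < size (E n))%N /\ nth 0 (E n) k = z]).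
  exact: card_nth.
apply/seteqP; split=> k /=; rewrite E_size//.
  move=> kz; have [kn|kn] := ltnP k n.-1.*2.+1; first by rewrite -(enumCE nn kn).
  by have := enumC_gt nn kn; rewrite kz ltNge hz.
by move=> [kn kz]; rewrite (enumCE nn kn).
Qed.

End Enumeration.

(** * Localization of the spectrum *)

Record left_spectrum (R : realType) (m : nat) (W : fourier R) (x0 : R) (N : nat)
    (E : seq R[i]) : Prop := LeftSpectrum {
  left_sorted : sorted (@lexC R) E;
  left_size : size E = N;
  left_lt : forall z, z \in E -> complex.Re z < x0;
  left_eigenvalue : forall z, z \in E -> Defs.eigenvalue m W z;
  left_resolvent : forall z, complex.Re z <= x0 -> z \notin E ->
    resolvent_set m W z;
  left_multiplicity : forall z, complex.Re z <= x0 ->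
    alg_multiplicity m W z (count_mem z E)
}.

Lemma count_flatten_nseq (T : eqType) (f : T -> nat) (S : seq T) (z : T) :
  uniq S -> count_mem z (flatten [seq nseq (f y) y | y <- S]) =
  if z \in S then f z else 0%N.
Proof.
move=> uS; rewrite count_flatten -map_comp sumnE big_map.
have [zS|zS] := boolP (z \in S).
  rewrite (bigD1_seq z)//= count_nseq/= eqxx mul1n big1 ?addn0// => y yz.
  by rewrite count_nseq/= (negbTE yz).
apply: big1_seq => y /andP[_ yS]; rewrite /= count_nseq/=.
by case: eqP yS => [->|//]; rewrite (negbTE zS).
Qed.

Lemma left_spectrum_exists (R : realType) (m : nat) (W : fourier R) (x0 : R)
    (N : nat) (G : 'M[R[i]]_N.+1) (u : 'I_N.+1 -> fourier R) :
  decoupled m W x0 G u -> exists E, left_spectrum m W x0 N.+1 E.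
Proof.
move=> dec; have [S [uS S0 sumS]] := sum_rank_geigenspace G.
pose E0 := flatten [seq nseq (\rank (geigenspace G z)) z | z <- S].
have cE0 z : count_mem z E0 = \rank (geigenspace G z).
  rewrite /E0 count_flatten_nseq//.
  by case: ifPn => // zS; apply/esym/S0.
have memE z : (z \in sort (@lexC R) E0) = (0 < \rank (geigenspace G z))%N.
  by rewrite mem_sort -has_pred1 has_count cE0.
exists (sort (@lexC R) E0); split.
- exact/sort_sorted/lexC_total.
- rewrite size_sort /E0 size_flatten /shape -map_comp sumnE big_map.
  apply: (etrans _ sumS).
  by apply: eq_bigr => z _ /=; rewrite size_nseq.
- by move=> z; rewrite memE => /(rank_left dec).
- by move=> z; rewrite memE => /(rank_eigenvalue dec).
- move=> z hz; rewrite memE -eqn0Ngt => /eqP r0.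
  exact: (rank_resolvent dec).
- move=> z hz; have := permP (permEl (perm_sort (@lexC R) E0)) (pred1 z) => ->.
  by rewrite cE0; apply: (rank_multiplicity dec).
Qed.

Lemma nrm_ltC (R : realType) (z : R[i]) (x : R) : nrm z < x -> `|z| < x%:C.
Proof. by rewrite -nrmE ltcR. Qed.

Theorem theorem1p1 (R : realType) (m : nat) (hm : (0 < m)%N)
    (V : fourier R) (hV : sobolev (- m%:R) V) :
  exists (eps M : R) (n0 : nat),
    [/\ 0 < eps, 1 <= M, (0 < n0)%N &
      forall W : fourier R, sobolev (- m%:R) W ->
        (sobolev_norm (- m%:R) (fun k => W k - V k)%R <= eps%:E)%E ->
        exists lam : nat -> R[i],
          [/\ eigenvalue_enumeration m W lam,
            [set k | cone m M n0 (lam k)] #= `I_(2 * n0 - 1)%N &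
            forall n : nat, (n0 <= n)%N ->
              `|lam (2 * n - 1)%N - (n%:R ^+ (2 * m) * pi ^+ (2 * m) : R)%:C|
                < n%:R ^+ m /\
              `|lam (2 * n)%N - (n%:R ^+ (2 * m) * pi ^+ (2 * m) : R)%:C|
                < n%:R ^+ m]].
Proof.
have [eps [n1 [eps0 n1_gt0 hsW]]] := hs_small hm hV.
(* [sep_right] yields indices from [n0.-1] on, which must be at least [n1]; the
   constant [M] is the one that [sep_left] asks for *)
pose n0 := n1.+2; pose M : R := n0%:R ^+ (2 * m) + n0%:R ^+ m + 1.
have n0_gt0 : (0 < n0)%N by [].
exists eps, M, n0; split=> //.
  by rewrite /M lerDr addr_ge0// exprn_ge0.
move=> W _ /hsW{hsW} hsW.
have free p z : (n1 <= p)%N -> sep m p z -> ~ Defs.eigenvalue m W z.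
  move=> pn hz [f [sf f0 e]]; apply: f0.
  exact: (no_eigenvalue (leq_trans n1_gt0 pn) hz (hsW _ _ pn hz) sf e).
have /choice[E hE] : forall n, exists E, (n0 <= n)%N ->
    left_spectrum m W (gap R m n) n.-1.*2.+1 E.
  move=> n; have [nn|nn] := leqP n0 n; last by exists [::].
  have [p pn hz] := gap_sep R hm (isT : (1 < n0)%N) nn.
  have pn1 : (n1 <= p)%N by apply: leq_trans pn.
  have [G [u dec]] := sobolev_gap hm (leq_trans (isT : (1 < n0)%N) nn)
    (leq_trans n1_gt0 pn1) hz (hsW _ _ pn1 hz).
  by have [E hE] := left_spectrum_exists dec; exists E.
have x_mono n p : (n0 <= n)%N -> (n <= p)%N -> gap R m n <= gap R m p.
  by move=> nn; apply: gap_mono => //; apply: leq_trans nn.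
have x_unb (B : R) : exists2 n, (n0 <= n)%N & B <= gap R m n.
  exists (maxn n0 (Num.bound `|B|).+1); first exact: leq_maxl.
  apply: le_trans (gap_ge R hm _); last by rewrite leq_max.
  rewrite lerBrDr; apply: le_trans (_ : (Num.bound `|B|).+1%:R <= _); last first.
    by rewrite ler_nat leq_maxr.
  rewrite -natr1 lerD2r; apply: le_trans (ler_norm B) _.
  exact/ltW/archi_boundP.
have Es n : (n0 <= n)%N -> sorted (@lexC R) (E n) by move=> /hE[].
have Ez n : (n0 <= n)%N -> size (E n) = n.-1.*2.+1 by move=> /hE[].
have El n z : (n0 <= n)%N -> z \in E n -> complex.Re z < gap R m n.
  by move=> /hE[] _ _ h _ _ _; apply: h.
(* both counts are the dimension of one root space *)
have Ec n z : (n0 <= n)%N -> complex.Re z <= gap R m n ->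
    count_mem z (E n.+1) = count_mem z (E n).
  move=> nn hz; have hz' := le_trans hz (x_mono n n.+1 nn (leqnSn n)).
  apply: (@has_dim_uniq R (root_space m W z)).
    exact: (left_multiplicity (hE _ (leqW nn)) hz').
  exact: (left_multiplicity (hE _ nn) hz).
pose lam := enumC n0 E.
have lam_mem n k (nn : (n0 <= n)%N) (kn : (k < n.-1.*2.+1)%N) : lam k \in E n.
  exact: (enumC_mem n0_gt0 Es Ez El Ec nn kn).
have lam_lt n k (nn : (n0 <= n)%N) (kn : (k < n.-1.*2.+1)%N) :
  complex.Re (lam k) < gap R m n.
  exact: (enumC_lt n0_gt0 Es Ez El Ec nn kn).
have lam_gt n k (nn : (n0 <= n)%N) (kn : (n.-1.*2.+1 <= k)%N) :
  gap R m n < complex.Re (lam k).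
  exact: (enumC_gt n0_gt0 x_mono Es Ez El Ec nn kn).
have lam_eig k : Defs.eigenvalue m W (lam k).
  have nn : (n0 <= n0 + k)%N by apply: leq_addr.
  apply: (left_eigenvalue (hE _ nn)); apply: lam_mem => //; lia.
exists lam; split.
- split=> //.
  + apply/seteqP; split=> z; last first.
      by move=> [k _ <-]; apply: eigenvalue_spectrum.
    move=> zs; have [n nn hz] := x_unb (complex.Re z).
    have zE : z \in E n.
      by apply/negPn/negP => /(left_resolvent (hE _ nn) hz).
    have : (0 < count_mem z (E n))%N by rewrite -has_count has_pred1.
    move=> c0; have := enumC_card n0_gt0 x_mono Es Ez El Ec nn hz.
    case: (count_mem z (E n)) c0 => // c _ /eq_cardSP[k /= kz _].
    by exists k.
  + move=> z; have [n nn hz] := x_unb (complex.Re z).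
    exists (count_mem z (E n)); split; first exact: (left_multiplicity (hE _ nn) hz).
    exact: (enumC_card n0_gt0 x_mono Es Ez El Ec nn hz).
  + exact: (enumC_cvg n0_gt0 x_mono x_unb Es Ez El Ec).
  + move=> k; have := enumC_lex n0_gt0 Es Ez El Ec k; rewrite -/lam.
    by case/orP => [h|/andP[/eqP h h']]; [left|right].
- rewrite (_ : [set _ | _] = `I_(2 * n0 - 1)) ?card_eqxx//.
  apply/seteqP; split=> k; rewrite /cone/= -/(gap R m n0).
    move=> [_ h]; rewrite ltnNge; apply/negP => kn.
    have kn' : (n0.-1.*2.+1 <= k)%N by move: kn; rewrite /n0; lia.
    by have := lam_gt n0 k (leqnn _) kn'; rewrite ltNge h.
  move=> kn; split; last first.
    by apply/ltW/lam_lt => //; move: kn; rewrite /n0; lia.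
  rewrite leNgt; apply/negP => h.
  apply: (@free n0 (lam k) _ _ (lam_eig k)); first by rewrite /n0; lia.
  by apply: (sep_left n0_gt0 _ h); rewrite /M lerDl.
- move=> n nn.
  have disc k : (n.-1.*2.+1 <= k)%N -> (k < n.*2.+1)%N ->
      `|lam k - (n%:R ^+ (2 * m) * pi ^+ (2 * m) : R)%:C| < n%:R ^+ m.
    move=> k1 k2; rewrite -/(mu R m n).
    have -> : n%:R ^+ m = (n%:R ^+ m : R)%:C by rewrite rmorphXn/= rmorph_nat.
    apply: nrm_ltC.
    have h1 := lam_gt n k nn k1; have h2 := lam_lt n.+1 k (leqW nn) k2.
    have : exists2 a, (n0 <= a)%N & nrm (lam k - (mu R m a)%:C) < a%:R ^+ m.
      apply: contrapT => no.
      have hd a : (n0 <= a)%N -> a%:R ^+ m <= nrm (lam k - (mu R m a)%:C).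
        by move=> na; rewrite leNgt; apply/negP => ha; apply: no; exists a.
      have [|p pn hz] := sep_right hm (isT : (1 < n0)%N) _ hd.
        by apply/ltW/(le_lt_trans _ h1)/x_mono.
      apply: (@free p (lam k) _ hz (lam_eig k)).
      exact: leq_trans pn.
    move=> [a na ha].
    by have := disc_unique hm n0_gt0 nn (ltW h1) (ltW h2) na ha => <-.
  have n_gt0 : (0 < n)%N by apply: leq_trans nn.
  by split; apply: disc; lia.
Qed.
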